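(* Let the integers $a(n)$ be defined by $$\sum_{n=0}^{\infty}a(n)q^n = f_1f_3^6 .$$ Let $p\geq 5$ be a prime and define $$\omega(p) := a\left( \frac{19}{24}(p^2-1) \right)+p^2\left( \frac{-2}{p} \right)_L\left( \frac{-\frac{19}{24}(p^2-1)}{p} \right)_L .$$ (i) If $\omega(p) \equiv 0 \pmod{2}$, then for all integers $n,k\geq 0$ and $1\leq j \leq p-1$, $$ped\left( 9p^{4k+4}n + 9p^{4k+3}j + \frac{57\cdot p^{4k+4}-1}{8} \right) \equiv 0 \pmod{24}.$$ Furthermore, for all integers $n,k\geq 0$ such that $19 \nmid (24n+19)$, $$ped(9n+7) \equiv ped\left( 9\cdot 19^{4k+2}n + \frac{57\cdot 19^{4k+2}-1}{8} \right) \pmod{24}.$$ (ii) If $\omega(p) \equiv 1 \pmod{2}$, then for all integers $n,k\geq 0$ and $1\leq j \leq p-1$, $$ped\left( 9p^{6k+6}n + 9p^{6k+5}j + \frac{57\cdot p^{6k+6}-1}{8} \right) \equiv 0 \pmod{24}.$$ Furthermore, if $p\neq 19$, then for all integers $n,k\geq 0$ such that $p \nmid (24n+19)$, $$ped\left( 9p^{6k+2}n + \frac{57\cdot p^{6k+2}-1}{8} \right) \equiv 0 \pmod{24}.$$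
   Context: For an integer $n\ge 0$, $ped(n)$ denotes the number of partitions of $n$ in which the even parts are distinct and the odd parts are unrestricted, with $ped(0)=1$. Equivalently, $\sum_{n=0}^{\infty} ped(n)q^n = f_4/f_1$, where for an integer $k\ge 1$, $f_k := (q^k;q^k)_\infty=\prod_{m=1}^{\infty}(1-q^{km})$ (as formal power series in $q$). For a prime $p\geq 3$ and an integer $a$, $\left(\frac{a}{p}\right)_L$ is the Legendre symbol: it equals $1$ if $p\nmid a$ and $a$ is a quadratic residue modulo $p$, $0$ if $p\mid a$, and $-1$ if $a$ is a quadratic nonresidue modulo $p$. Note that $\frac{1}{24}(p^2-1)$ is an integer for every prime $p\ge5$. *)

(* Defs.v *)
From mathcomp Require Import all_boot all_order all_algebra.

Set Implicit Arguments.
Unset Strict Implicit.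
Unset Printing Implicit Defensive.

Import GRing.Theory.

(* A partition of n is given by the multiplicities m i of its parts i.+1, for
   i < n; none of these multiplicities exceeds n. *)
Definition ped (n : nat) : nat :=
  #|[set m : {ffun 'I_n -> 'I_n.+1} |
      (\sum_(i < n) i.+1 * m i == n) &&
      [forall i : 'I_n, ~~ odd i.+1 ==> (m i <= 1)]]|.

Local Open Scope ring_scope.

(* Formal power series over int, as coefficient sequences. *)
Definition fps := nat -> int.

Definition fps1 : fps := fun n => (n == 0%N)%:R.

Definition fps_mul (u v : fps) : fps :=
  fun n => \sum_(i < n.+1) u i * v (n - i)%N.

Definition fps_exp (u : fps) (e : nat) : fps := iter e (fps_mul u) fps1.

(* For k >= 1, the factors 1 - q^(k m) with m > n do not affect the
   coefficient of q^n in (q^k; q^k)_oo. *)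
Definition euler_f (k : nat) : fps :=
  fun n => (\prod_(1 <= m < n.+1) (1 - 'X^(k * m)) : {poly int})`_n.

Definition a : fps := fps_mul (euler_f 1) (fps_exp (euler_f 3) 6).

Definition legendre (x : int) (p : nat) : int :=
  if (p%:Z %| x)%Z then 0
  else if [exists y : 'I_p, ((y : nat)%:Z ^+ 2 == x %[mod p%:Z])%Z] then 1
  else -1.

(* 24 divides p ^ 2 - 1 for every prime p >= 5, so the division is exact. *)
Definition delta (p : nat) : nat := (19 * ((p ^ 2 - 1) %/ 24))%N.

Definition omega (p : nat) : int :=
  a (delta p) + p%:Z ^+ 2 * legendre (-2) p * legendre (- (delta p)%:Z) p.

(* Main.v *)
(* Write f_k for the eta products and G for the generating function of ped.
   Gauss' product psi(q) = f_2^2/f_1 and phi(q) psi(q^2) = psi(q)^2 give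
   G = psi(q^2)/psi(-q) = psi(q)/phi(-q^2).  Splitting the theta series by
   residues mod 3, the first form yields 3 | ped(9n+7), and the second one
   ped(9n+7) = 4 [q^n] P(q) psi(q^6) mod 8, where P(q) is the sum of
   q^(k(3k+1)/2) over all integers k.  Since P = f_1 and psi = f_1^3 mod 2, it
   follows that ped(9n+7) = 12 a(n) mod 24.

   Moreover [q^n] P(q) psi(q^6) is a quarter of the number R(N) of integral
   solutions of x^2 + 2z^2 = N := 24n+19.  By the arithmetic of Z[sqrt(-2)],
   R(p^e m) = (e+1) R(m) for p not dividing m if p splits, while R(p^2 N) = R(N)
   and R(p m) = 0 if p is inert.  These rules determine the parity of a(n) in
   the progressions of part (i); they also show that a((19/24)(p^2 - 1)) is odd
   for p <> 19 and even for p = 19, so that omega(p) is always even and part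
   (ii) is vacuous. *)

(* The identities among theta series come from changes of variables between lattices that respect
   the exponents. In [phi_psi] and [section3_pent_om] the change is, up to signs and constants,
   multiplication by [1 + sqrt(-2)] or its conjugate, of norm 3, so the ring that later counts the
   solutions of x^2 + 2z^2 = N already governs the extraction of exponents modulo 3. Neither the
   triple product nor Euler's pentagonal number theorem is called upon. The product for psi is the
   limit of a finite identity, the product for phi(-q) follows from a relation between theta series,
   and P = f_1 modulo 2 is obtained by comparing cubes, since P^3 = psi = f_1^3 modulo 2. *)
From HB Require Import structures.
Require Import Defs.
From mathcomp Require Import all_boot all_order all_algebra.
From mathcomp Require Import boolp zify ring.

Set Implicit Arguments.
Unset Strict Implicit.
Unset Printing Implicit Defensive.

Import Order.TTheory GRing.Theory Num.Theory.
Local Open Scope ring_scope.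

(** * The ring of formal power series *)

(* A wrapper around [fps], so that the ring structure below cannot be confused
   with the pointwise one on functions. *)
Record series := Series { coefs : nat -> int }.

HB.instance Definition _ := gen_eqMixin series.
HB.instance Definition _ := gen_choiceMixin series.

Lemma seriesP u v : coefs u =1 coefs v -> u = v.
Proof. by case: u v => [u] [v] /= /funext ->. Qed.

Definition series_add u v := Series (fun n => coefs u n + coefs v n).
Definition series_opp u := Series (fun n => - coefs u n).
Definition series_mul u v := Series (fps_mul (coefs u) (coefs v)).

Fact series_addA : associative series_add.
Proof. by move=> u v w; apply: seriesP => n /=; rewrite addrA. Qed.
Fact series_addC : commutative series_add.
Proof. by move=> u v; apply: seriesP => n /=; rewrite addrC. Qed.
Fact series_add0 : left_id (Series (fun _ => 0)) series_add.
Proof. by move=> u; apply: seriesP => n /=; rewrite add0r. Qed.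
Fact series_addN : left_inverse (Series (fun _ => 0)) series_opp series_add.
Proof. by move=> u; apply: seriesP => n /=; rewrite addNr. Qed.

HB.instance Definition _ :=
  GRing.isZmodule.Build series series_addA series_addC series_add0 series_addN.

Definition truncation (n : nat) (u : series) : {poly int} :=
  \poly_(i < n.+1) coefs u i.

Lemma coef_truncation n u i : (i <= n)%N -> (truncation n u)`_i = coefs u i.
Proof. by move=> le_in; rewrite coef_poly ltnS le_in. Qed.

(** Through truncation, commutativity, associativity and the unit law are inherited from
    [{poly int}]. *)
Lemma coef_series_mul n u v i : (i <= n)%N ->
  coefs (series_mul u v) i = (truncation n u * truncation n v)`_i.
Proof.
move=> le_in; rewrite coefM; apply: eq_bigr => [[j /=]]; rewrite ltnS => le_ji _.
by rewrite !coef_truncation //; [apply: leq_trans le_in; apply: leq_subr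
                                |apply: leq_trans le_in].
Qed.

Lemma coefM_congr (p p' r r' : {poly int}) n :
  (forall i, (i <= n)%N -> p`_i = p'`_i) ->
  (forall i, (i <= n)%N -> r`_i = r'`_i) -> (p * r)`_n = (p' * r')`_n.
Proof.
move=> pp' rr'; rewrite !coefM; apply: eq_bigr => [[j /=]]; rewrite ltnS => le_jn _.
by rewrite pp' // rr' // leq_subr.
Qed.

Fact series_mulC : commutative series_mul.
Proof.
by move=> u v; apply: seriesP => n; rewrite !(@coef_series_mul n) // mulrC.
Qed.
Fact series_mulA : associative series_mul.
Proof.
move=> u v w; apply: seriesP => n; rewrite !(@coef_series_mul n) //.
transitivity (truncation n u * (truncation n v * truncation n w))`_n.
  by apply: coefM_congr => // i le_in; rewrite coef_truncation // (coef_series_mul _ _ le_in).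
rewrite mulrA; apply: coefM_congr => // i le_in.
by rewrite coef_truncation // (coef_series_mul _ _ le_in).
Qed.
Fact series_mul1 : left_id (Series fps1) series_mul.
Proof.
move=> u; apply: seriesP => n; rewrite (@coef_series_mul n) //.
rewrite -[RHS](coef_truncation u (leqnn n)) -[in RHS](mul1r (truncation n u)).
apply: coefM_congr => // i le_in.
by rewrite coef_truncation //= /fps1 coef1.
Qed.
Fact series_mulDl : left_distributive series_mul series_add.
Proof.
move=> u v w; apply: seriesP => n /=; rewrite /fps_mul -big_split /=.
by apply: eq_bigr => i _; rewrite mulrDl.
Qed.
Fact series_oner_neq0 : Series fps1 != 0.
Proof. by apply/eqP => /(congr1 (fun u => coefs u 0)). Qed.

HB.instance Definition _ := GRing.Zmodule_isComNzRing.Build series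
  series_mulA series_mulC series_mul1 series_mulDl series_oner_neq0.

Lemma coefs0 n : coefs 0 n = 0. Proof. by []. Qed.
Lemma coefs1 n : coefs 1 n = (n == 0%N)%:R. Proof. by []. Qed.
Lemma coefsD u v n : coefs (u + v) n = coefs u n + coefs v n.
Proof. by []. Qed.
Lemma coefsN u n : coefs (- u) n = - coefs u n. Proof. by []. Qed.
Lemma coefsB u v n : coefs (u - v) n = coefs u n - coefs v n.
Proof. by []. Qed.
Lemma coefsM u v n :
  coefs (u * v) n = \sum_(i < n.+1) coefs u i * coefs v (n - i)%N.
Proof. by []. Qed.
Lemma coefs0M u v : coefs (u * v) 0 = coefs u 0 * coefs v 0.
Proof. by rewrite coefsM big_ord_recl big_ord0 addr0. Qed.

Lemma coefs_natl m u n : coefs (m%:R * u) n = m%:R * coefs u n.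
Proof.
rewrite [m%:R * u]mulr_natl [m%:R * coefs u n]mulr_natl.
by elim: m => [|m IHm]; rewrite ?mulr0n // !mulrS coefsD IHm.
Qed.

Definition q : series := Series (fun n => (n == 1%N)%:R).

Lemma coefs_qM u n : coefs (q * u) n = if n is n'.+1 then coefs u n' else 0.
Proof.
rewrite coefsM; case: n => [|n]; first by rewrite big_ord_recl big_ord0 mul0r addr0.
rewrite big_ord_recl mul0r add0r big_ord_recl mul1r /= subSS subn0.
by rewrite big1 ?addr0 // => i _; rewrite mul0r.
Qed.

Lemma coefs_qnM k u n :
  coefs (q ^+ k * u) n = if (n < k)%N then 0 else coefs u (n - k).
Proof.
elim: k n => [|k IHk] n; first by rewrite expr0 mul1r subn0.
rewrite exprS -mulrA coefs_qM; case: n => [//|n]; by rewrite IHk ltnS subSS.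
Qed.

Lemma coefs_qn k n : coefs (q ^+ k) n = (n == k)%:R.
Proof.
rewrite -[q ^+ k]mulr1 coefs_qnM; case: ltnP => [/ltn_eqF -> //|le_kn].
by rewrite coefs1 subn_eq0 eqn_leq le_kn andbT.
Qed.

(** * Congruence up to a given order, and modulo an integer *)

Definition eq_upto n u v := forall i, (i <= n)%N -> coefs u i = coefs v i.

Lemma eq_upto_refl n u : eq_upto n u u. Proof. by []. Qed.
Lemma eq_upto_sym n u v : eq_upto n u v -> eq_upto n v u.
Proof. by move=> uv i /uv. Qed.
Lemma eq_upto_trans n u v w : eq_upto n u v -> eq_upto n v w -> eq_upto n u w.
Proof. by move=> uv vw i le_in; rewrite uv ?vw. Qed.
Lemma eq_upto_leq m n u v : (m <= n)%N -> eq_upto n u v -> eq_upto m u v.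
Proof. by move=> le_mn uv i /leq_trans-/(_ n le_mn)/uv. Qed.
Lemma eq_uptoM n u u' v v' :
  eq_upto n u u' -> eq_upto n v v' -> eq_upto n (u * v) (u' * v').
Proof.
move=> uu' vv' i le_in; rewrite !coefsM; apply: eq_bigr => [[j /=]].
rewrite ltnS => le_ji _; rewrite uu' ?vv' //; last exact: leq_trans le_in.
by apply: leq_trans le_in; apply: leq_subr.
Qed.
Lemma eq_uptoB n u u' v v' :
  eq_upto n u u' -> eq_upto n v v' -> eq_upto n (u - v) (u' - v').
Proof. by move=> uu' vv' i le_in; rewrite !coefsB uu' ?vv'. Qed.
Lemma eq_upto_prod n I (r : seq I) (P : pred I) (F F' : I -> series) :
  (forall i, P i -> eq_upto n (F i) (F' i)) ->
  eq_upto n (\prod_(i <- r | P i) F i) (\prod_(i <- r | P i) F' i).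
Proof. by move=> FF'; apply: big_ind2 => // *; apply: eq_uptoM. Qed.
Lemma eq_upto_qn n k u : (n < k)%N -> eq_upto n (q ^+ k * u) 0.
Proof. by move=> lt_nk i le_in; rewrite coefs_qnM (leq_ltn_trans le_in). Qed.
Lemma eq_uptoP u v : (forall n, eq_upto n u v) -> u = v.
Proof. by move=> uv; apply: seriesP => n; apply: uv (leqnn n). Qed.

(** Strong induction isolates the last term [coefs u i * 1] of the convolution. For [m = 0]
    divisibility means vanishing, so exact cancellation and cancellation modulo [m] both follow from
    it. *)
Lemma dvd_coefs_cancel m n u v : coefs v 0 = 1 ->
  (forall i, (i <= n)%N -> (m %| coefs (u * v) i)%Z) ->
  forall i, (i <= n)%N -> (m %| coefs u i)%Z.
Proof.
move=> v0 dv; elim/ltn_ind => i IHi le_in.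
have := dv i le_in; rewrite coefsM big_ord_recr /= subnn v0 mulr1.
suff /rpredDl-> : (m %| \sum_(j < i) coefs u j * coefs v (i - j)%N)%Z by [].
apply: rpred_sum => [[j /= lt_ji]] _.
by apply: dvdz_mulr; apply: IHi => //; apply: leq_trans (ltnW lt_ji) le_in.
Qed.

Lemma eq_upto_cancel n u v w : coefs w 0 = 1 ->
  eq_upto n (u * w) (v * w) -> eq_upto n u v.
Proof.
move=> w0 uv i le_in; apply/eqP; rewrite -subr_eq0 -coefsB -dvd0z.
apply: (dvd_coefs_cancel (v := w) (n := n)) => // j le_jn.
by rewrite mulrBl coefsB uv // subrr.
Qed.

Lemma series_cancel u v w : coefs w 0 = 1 -> u * w = v * w -> u = v.
Proof.
by move=> w0 uv; apply: eq_uptoP => n; apply: (eq_upto_cancel w0); rewrite uv.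
Qed.

(** The explicit witness lets a congruence be substituted as an equation and the result be closed by
    [ring]; [eqmodsP] returns to coefficients. *)
Definition eqmods (m : nat) (u v : series) := exists w, u = v + m%:R * w.

Lemma eqmodsP m u v :
  eqmods m u v <-> forall n, (m%:Z %| coefs u n - coefs v n)%Z.
Proof.
split=> [[w ->] n|uv].
  by rewrite coefsD addrC addKr coefs_natl natz dvdz_mulr.
exists (Series (fun n => ((coefs u n - coefs v n) %/ m%:Z)%Z)).
apply: seriesP => n; rewrite coefsD coefs_natl /= mulrC natz divzK //.
by rewrite addrC subrK.
Qed.

Lemma eqmods_cancel m u v w : coefs w 0 = 1 ->
  eqmods m (u * w) (v * w) -> eqmods m u v.
Proof.
move=> w0 /eqmodsP uv; apply/eqmodsP => n; rewrite -coefsB.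
apply: (dvd_coefs_cancel (v := w) (n := n)) => // j _.
by rewrite mulrBl coefsB.
Qed.

(** * Substitutions and dissections *)

(* [subst k u] is [u(q^k)]; for [k = 0] it is the constant term of [u]. *)
Definition subst k u :=
  Series (fun n => if (k %| n)%N then coefs u (n %/ k) else 0).

Fact subst_is_additive k : zmod_morphism (subst k).
Proof.
by move=> u v; apply: seriesP => n; rewrite coefsB /=; case: ifP; rewrite ?subrr.
Qed.
HB.instance Definition _ k :=
  GRing.isZmodMorphism.Build series series (subst k) (subst_is_additive k).

Fact subst_is_monoid_morphism k : monoid_morphism (subst k).
Proof.
split.
  apply: seriesP => n /=; rewrite /fps1; case: (posnP k) => [->|k_gt0].
    by rewrite dvd0n; case: eqP => [->|].
  case: ifP => [/dvdnP[m ->]|].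
    by rewrite mulnK // muln_eq0 [k == _]gtn_eqF ?orbF.
  by case: n => //; rewrite dvdn0.
move=> u v; apply: seriesP => n.
case: (posnP k) => [->|k_gt0].
  rewrite /= dvd0n; case: n => [|n] /=; last first.
    rewrite /fps_mul big1 // => [[i /= _]] _; rewrite !dvd0n.
    by case: i => [|i]; rewrite /= ?mulr0 ?mul0r.
  by rewrite /fps_mul !big_ord_recl !big_ord0.
rewrite (@coef_series_mul n) //.
transitivity (((truncation n u \Po 'X^k) * (truncation n v \Po 'X^k))`_n).
  rewrite -rmorphM coef_comp_poly_Xn //=; case: ifP => // _.
  by rewrite -(coef_series_mul u v (leq_div n k)).
suff E w i : (i <= n)%N ->
    (truncation n w \Po 'X^k)`_i = (truncation n (subst k w))`_i.
  by apply: coefM_congr => i /E.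
move=> le_in; rewrite coef_comp_poly_Xn // (coef_truncation (subst k w) le_in) /=.
by case: ifP => // _; rewrite coef_truncation // (leq_trans (leq_div _ _)).
Qed.
HB.instance Definition _ k :=
  GRing.isMonoidMorphism.Build series series (subst k) (subst_is_monoid_morphism k).

Lemma subst_q k : (0 < k)%N -> subst k q = q ^+ k.
Proof.
move=> k_gt0; apply: seriesP => n; rewrite coefs_qn /=.
case: ifP => [/dvdnP[m ->]|ndiv]; last by case: eqP ndiv => // ->; rewrite dvdnn.
by rewrite mulnK // -{2}[k]mul1n eqn_pmul2r.
Qed.

Lemma subst_subst k l u : (0 < k)%N -> (0 < l)%N ->
  subst k (subst l u) = subst (k * l) u.
Proof.
move=> k_gt0 l_gt0; apply: seriesP => n /=.
case: ifP => [/dvdnP[m ->]|ndiv]; last first.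
  by case: ifP => // /(dvdn_trans (dvdn_mulr l (dvdnn k))); rewrite ndiv.
by rewrite mulnK // [(k * l)%N]mulnC dvdn_pmul2r // divnMr.
Qed.

Definition negq u := Series (fun n => (-1) ^+ n * coefs u n).

Fact negq_is_additive : zmod_morphism negq.
Proof. by move=> u v; apply: seriesP => n; rewrite coefsB /= mulrBr. Qed.
HB.instance Definition _ :=
  GRing.isZmodMorphism.Build series series negq negq_is_additive.

Fact negq_is_monoid_morphism : monoid_morphism negq.
Proof.
split; first by apply: seriesP => [[|n]]; rewrite /= ?mulr1 ?mulr0.
move=> u v; apply: seriesP => n /=; rewrite /fps_mul mulr_sumr.
apply: eq_bigr => [[i /=]]; rewrite ltnS => le_in _.
by rewrite -{1}(subnKC le_in) exprD mulrACA.
Qed.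
HB.instance Definition _ :=
  GRing.isMonoidMorphism.Build series series negq negq_is_monoid_morphism.

Lemma negq_q : negq q = - q.
Proof. by apply: seriesP => [[|[|n]]]; rewrite coefsN /= ?mulr0 ?oppr0. Qed.

Lemma negq_substE k u :
  negq (subst k u) = if odd k then subst k (negq u) else subst k u.
Proof.
apply: seriesP => n; rewrite (fun_if coefs) (fun_if (@^~ n)) /=.
case: ifP => [/dvdnP[m ->]|_]; last by rewrite mulr0; case: ifP.
case: (posnP k) => [->|k_gt0]; first by rewrite muln0 expr0 mul1r.
rewrite mulnK // -(signr_odd _ (_ * _)) oddM.
by case: (odd k); rewrite ?andbT ?andbF ?expr0 ?mul1r ?signr_odd.
Qed.

Lemma eqmods_negq u : eqmods 2 (negq u) u.
Proof.
apply/eqmodsP => n /=; rewrite -signr_odd; case: (odd n); rewrite ?expr1 ?expr0; lia.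
Qed.

Definition section3 r u := Series (fun n => coefs u (3 * n + r)).

Lemma coefs_section3 r u n : coefs (section3 r u) n = coefs u (3 * n + r).
Proof. by []. Qed.

Fact section3_is_additive r : zmod_morphism (section3 r).
Proof. by move=> u v; apply: seriesP => n; rewrite coefsB. Qed.
HB.instance Definition _ r :=
  GRing.isZmodMorphism.Build series series (section3 r) (section3_is_additive r).

Lemma section3_qn r i u : (r < 3)%N ->
  section3 r (q ^+ i * subst 3 u) =
    if (i %% 3 == r)%N then q ^+ (i %/ 3) * u else 0.
Proof.
move=> r_lt3; apply: seriesP => n; rewrite coefs_section3 (fun_if coefs).
rewrite (fun_if (@^~ n)) !coefs_qnM /=.
case: (ltnP (3 * n + r) i) => [lt|le].
  by case: ifP => // /eqP ir; case: ltnP => //; lia.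
case: ifP => d3; case: eqP => ir //.
- by case: ltnP => h; [lia | congr coefs; lia].
- lia.
- by case: ltnP => // h; lia.
Qed.

Lemma section3_subst r u : (r < 3)%N ->
  section3 r (subst 3 u) = if r == 0%N then u else 0.
Proof.
move=> r_lt3; rewrite -[subst 3 u]mul1r -(expr0 q) section3_qn //.
by rewrite eq_sym expr0 mul1r.
Qed.

Lemma coefs_subst_section3 r u n : (r < 3)%N ->
  coefs (q ^+ r * subst 3 (section3 r u)) n =
    if (n %% 3 == r)%N then coefs u n else 0.
Proof.
move=> r_lt3; rewrite coefs_qnM /=; case: ltnP => [lt_nr|le_rn].
  by case: eqP => //; lia.
case: eqP => nr; last by case: ifP => //; lia.
by case: ifP => d3; [congr coefs|]; lia.
Qed.

Lemma dissection3 u : u = \sum_(r < 3) q ^+ r * subst 3 (section3 r u).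
Proof.
apply: seriesP => n; rewrite !big_ord_recl big_ord0 !coefsD !coefs_subst_section3 //=.
by have := ltn_pmod n (isT : 0 < 3)%N; case: (n %% 3)%N => [|[|[|]]] //;
  rewrite ?addr0 ?add0r.
Qed.

(** Extraction of a residue class of exponents is linear over series in q^3, so a denominator can be
    cleared by a factor [subst 3 v] before extracting. *)
Lemma section3M r u v : (r < 3)%N ->
  section3 r (subst 3 v * u) = v * section3 r u.
Proof.
move=> r_lt3; rewrite {1}[u]dissection3 mulr_sumr raddf_sum /=.
rewrite (bigD1 (Ordinal r_lt3)) //= mulrCA -rmorphM section3_qn // modn_small //.
rewrite eqxx divn_small // mul1r big1 ?addr0 // => s.
rewrite -val_eqE /= => /negPf ne_sr.
by rewrite mulrCA -rmorphM section3_qn // modn_small // ne_sr.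
Qed.


(** * The calculus of congruences *)

Section Congruences.
Variable m : nat.
Implicit Types u v w : series.

Lemma eqmods_refl u : eqmods m u u.
Proof. by exists 0; rewrite mulr0 addr0. Qed.
Lemma eqmods_sym u v : eqmods m u v -> eqmods m v u.
Proof. by move=> [w ->]; exists (- w); rewrite mulrN addrK. Qed.
Lemma eqmods_trans u v w : eqmods m u v -> eqmods m v w -> eqmods m u w.
Proof. by move=> [x ->] [y ->]; exists (x + y); ring. Qed.
Lemma eqmodsN u u' : eqmods m u u' -> eqmods m (- u) (- u').
Proof. by move=> [x ->]; exists (- x); ring. Qed.
Lemma eqmodsD u u' v v' :
  eqmods m u u' -> eqmods m v v' -> eqmods m (u + v) (u' + v').
Proof. by move=> [x ->] [y ->]; exists (x + y); ring. Qed.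
Lemma eqmodsM u u' v v' :
  eqmods m u u' -> eqmods m v v' -> eqmods m (u * v) (u' * v').
Proof.
by move=> [x ->] [y ->]; exists (x * v' + y * u' + m%:R * x * y); ring.
Qed.
Lemma eqmodsX n u u' : eqmods m u u' -> eqmods m (u ^+ n) (u' ^+ n).
Proof.
move=> uu'; elim: n => [|n IHn]; first exact: eqmods_refl.
by rewrite !exprS; apply: eqmodsM.
Qed.
Lemma eqmods_morph (f : {rmorphism series -> series}) u u' :
  eqmods m u u' -> eqmods m (f u) (f u').
Proof. by move=> [x ->]; exists (f x); rewrite rmorphD rmorphM rmorph_nat. Qed.
Lemma eqmods_section3 r u u' :
  eqmods m u u' -> eqmods m (section3 r u) (section3 r u').
Proof.
move=> [x ->]; exists (section3 r x); rewrite raddfD; congr (_ + _).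
by rewrite !mulr_natl raddfMn.
Qed.
End Congruences.

Section Frobenius.
Variables (p : nat) (p_prime : prime p).
Implicit Types u v w : series.

Lemma eqmods_exprD u v : eqmods p ((u + v) ^+ p) (u ^+ p + v ^+ p).
Proof.
case: p p_prime => // k pr_k.
exists (\sum_(i < k) (u ^+ (k - i) * v ^+ i.+1) *+ ('C(k.+1, i.+1) %/ k.+1)).
rewrite exprDn big_ord_recl big_ord_recr /= subn0 bin0 expr0 mulr1 mulr1n.
rewrite subnn mul1r binn mulr1n [X in _ + X]addrC addrA; congr (_ + _).
rewrite mulr_sumr; apply: eq_bigr => [[i /= lt_ik]] _.
by rewrite subSS mulr_natl -mulrnA divnK // prime_dvd_bin // !ltnS.
Qed.

Definition frobenius_at u := eqmods p (u ^+ p) (subst p u).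

Lemma frobenius_atD u v : frobenius_at u -> frobenius_at v -> frobenius_at (u + v).
Proof.
move=> fu fv; apply: eqmods_trans (eqmods_exprD u v) _.
by rewrite rmorphD; apply: eqmodsD.
Qed.
(** Additivity applied to u + (-u) = 0 gives (-u)^p = -u^p modulo p without separating p = 2 from
    odd p. *)
Lemma frobenius_atN u : frobenius_at u -> frobenius_at (- u).
Proof.
move=> fu; rewrite /frobenius_at rmorphN -[_ ^+ p]subr0 -[0](subrr (u ^+ p)).
rewrite opprB addrA addrC; apply: eqmods_sym.
apply: (eqmods_trans (eqmodsN (eqmods_sym fu))).
rewrite -[X in eqmods _ X _]addr0; apply: eqmodsD; first exact: eqmods_refl.
rewrite addrC; apply: eqmods_trans (eqmods_exprD u (- u)).
by rewrite subrr expr0n gtn_eqF ?prime_gt0 //; apply: eqmods_refl.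
Qed.
Lemma frobenius_atM u v : frobenius_at u -> frobenius_at v -> frobenius_at (u * v).
Proof. by rewrite /frobenius_at exprMn rmorphM; apply: eqmodsM. Qed.
Lemma frobenius_at1 : frobenius_at 1.
Proof. by rewrite /frobenius_at expr1n rmorph1; apply: eqmods_refl. Qed.
Lemma frobenius_atq : frobenius_at q.
Proof. by rewrite /frobenius_at subst_q ?prime_gt0 //; apply: eqmods_refl. Qed.

(** The series satisfying the congruence are closed under the ring operations and include q, hence
    every polynomial in q; the coefficient at [n] only sees the truncation [t n] of [u]. *)
Lemma eqmods_frobenius u : eqmods p (u ^+ p) (subst p u).
Proof.
pose t n := \sum_(i < n.+1) (coefs u i)%:~R * q ^+ i.
have tP n : eq_upto n (t n) u.
  move=> i le_in; rewrite /t.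
  have -> : coefs (\sum_(j < n.+1) (coefs u j)%:~R * q ^+ j) i =
            \sum_(j < n.+1) coefs u j * (i == j)%:R.
    rewrite (big_morph (fun w => coefs w i) (fun _ _ => erefl) erefl).
    apply: eq_bigr => j _; rewrite -coefs_qn.
    have [k [-> | ->]] : exists k : nat, coefs u j = k%:Z \/ coefs u j = - k%:Z.
      by case: (coefs u j) => k; [exists k; left | exists k.+1; right].
    - by rewrite -pmulrn coefs_natl natz.
    - by rewrite mulrNz -pmulrn mulNr coefsN coefs_natl natz mulNr.
  rewrite (bigD1 (Ordinal (le_in : (i < n.+1)%N))) //= eqxx mulr1 big1 ?addr0 //.
  by move=> j; rewrite -val_eqE eq_sym /= => /negPf ->; rewrite mulr0.
have f0 : frobenius_at 0.
  rewrite -(subrr 1); apply: frobenius_atD; last apply: frobenius_atN;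
    exact: frobenius_at1.
have ft n : frobenius_at (t n).
  rewrite /t; apply: (big_ind frobenius_at); first last.
  - move=> i _; apply: frobenius_atM; last first.
      elim: (i : nat) => [|k IHk]; first exact: frobenius_at1.
      by rewrite exprS; apply: frobenius_atM IHk; apply: frobenius_atq.
    have nat_case k : frobenius_at k%:R.
      elim: k => [|k IHk]; last first.
        by rewrite mulrS; apply: frobenius_atD IHk; apply: frobenius_at1.
      exact: f0.
    by case: (coefs u i) => k; rewrite ?NegzE ?mulrNz -?pmulrn //; apply: frobenius_atN.
  - exact: frobenius_atD.
  - exact: f0.
apply/eqmodsP => n; have /eqmodsP/(_ n) dvd_t := ft n.
suff [<- <-] : coefs (t n ^+ p) n = coefs (u ^+ p) n /\
   coefs (subst p (t n)) n = coefs (subst p u) n by [].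
split; last by rewrite /=; case: ifP => // _; apply: tP; apply: leq_div.
have /(_ n (leqnn n)) // : eq_upto n (t n ^+ p) (u ^+ p).
elim: p => [|k IHk]; first exact: eq_upto_refl.
by rewrite !exprS; apply: eq_uptoM.
Qed.
End Frobenius.

(** * Theta series *)

(* [u] is the sum of [q^(e x)] over the [x] in [D] with [e x >= 0], given
   enumerations of the level sets of [e]. *)
Definition genfun (T : eqType) (D : pred T) (e : T -> int) (u : series) :=
  exists s : nat -> seq T, forall n,
    [/\ uniq (s n), forall x, (x \in s n) = D x && (e x == n%:Z)
      & coefs u n = (size (s n))%:Z].

Lemma genfun_inj (T : eqType) (D : pred T) e u v :
  genfun D e u -> genfun D e v -> u = v.
Proof.
move=> [s sP] [t tP]; apply: seriesP => n.
have [us ms ->] := sP n; have [ut mt ->] := tP n; congr (_%:Z).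
by apply/perm_size/uniq_perm => // x; rewrite ms mt.
Qed.

(** The change-of-variables principle: an identity of theta series becomes a pair of inverse maps
    preserving exponents, to be checked by integer arithmetic. *)
Lemma genfun_bij (T T' : eqType) (h : T -> T') (g : T' -> T)
    (D : pred T) (D' : pred T') e e' u :
  (forall x, D x -> [/\ D' (h x), g (h x) = x & e' (h x) = e x]) ->
  (forall y, D' y -> D (g y) /\ h (g y) = y) ->
  genfun D e u -> genfun D' e' u.
Proof.
move=> hP gP [s sP]; exists (fun n => map h (s n)) => n.
have [us ms ->] := sP n; split; last by rewrite size_map.
  rewrite map_inj_in_uniq // => x y; rewrite !ms => /andP[/hP[_ gx _] _].
  by move=> /andP[/hP[_ gy _] _] hxy; rewrite -gx hxy gy.
move=> y; apply/mapP/andP => [[x] | [Dy /eqP ey]].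
  by rewrite ms => /andP[/hP[Dx _ ex] /eqP xn] ->; rewrite Dx ex xn eqxx.
have [Dg hg] := gP _ Dy; exists (g y) => //; rewrite ms Dg /=.
by have [_ _ <-] := hP _ Dg; rewrite hg ey.
Qed.

Lemma genfun_split (T : eqType) (D D1 D2 : pred T) e u v :
  (forall x, D x = D1 x || D2 x) -> (forall x, D1 x -> D2 x -> false) ->
  genfun D1 e u -> genfun D2 e v -> genfun D e (u + v).
Proof.
move=> DE disj [s sP] [t tP]; exists (fun n => s n ++ t n) => n.
have [us ms su] := sP n; have [ut mt sv] := tP n; split.
- rewrite cat_uniq us ut andbT /=; apply/hasPn => x; rewrite mt => /andP[D2x _].
  by apply/negP => /=; rewrite ms => /andP[/disj/(_ D2x)].
- by move=> x; rewrite mem_cat ms mt DE andb_orl.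
- by rewrite coefsD su sv size_cat PoszD.
Qed.

Lemma genfunM (T T' : eqType) (D : pred T) (D' : pred T') e e' u v :
  (forall x, D x -> 0 <= e x) -> (forall y, D' y -> 0 <= e' y) ->
  genfun D e u -> genfun D' e' v ->
  genfun (fun z => D z.1 && D' z.2) (fun z => e z.1 + e' z.2) (u * v).
Proof.
move=> e_ge0 e'_ge0 [s sP] [t tP].
pose w n i := [seq (x, y) | x <- s i, y <- t (n - i)%N].
have mw n i z : (z \in w n i) = (z.1 \in s i) && (z.2 \in t (n - i)%N).
  apply/allpairsP/andP => [[z' [? ? ->]] // | [z1 z2]].
  by exists z; split=> //; case: z {z1 z2}.
exists (fun n => flatten [seq w n i | i <- iota 0 n.+1]) => n; split.
- elim: (iota 0 n.+1) (iota_uniq 0 n.+1) => //= i r IHr /andP[ir /IHr ur].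
  rewrite cat_uniq ur andbT; apply/andP; split.
    apply: allpairs_uniq => [||[x y] [x' y'] //].
      by have [] := sP i.
    by have [] := tP (n - i)%N.
  apply/hasPn => z /flatten_mapP[j jr]; rewrite mw => /andP[z1 _]; apply/negP => /=.
  rewrite mw => /andP[z1' _]; move: z1 z1'.
  have [_ -> _] := sP j; have [_ -> _] := sP i.
  by move=> /andP[_ /eqP ->] /andP[_ /eqP[ij]]; rewrite -ij jr in ir.
- move=> z; apply/flatten_mapP/andP => [[i] | [/andP[D1 D2] /eqP ez]].
    rewrite mem_iota mw add0n ltnS /= => le_in.
    have [_ -> _] := sP i; have [_ -> _] := tP (n - i)%N.
    by move=> /andP[/andP[-> /eqP ->] /andP[-> /eqP ->]]; split => //; lia.
  have := e_ge0 _ D1; have := e'_ge0 _ D2 => e2 e1.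
  exists `|e z.1|%N; first by rewrite mem_iota; lia.
  rewrite mw; have [_ -> _] := sP `|e z.1|%N; have [_ -> _] := tP (n - `|e z.1|)%N.
  by rewrite D1 D2 /=; lia.
- rewrite coefsM size_flatten /shape -map_comp sumnE big_map.
  rewrite -(big_mkord xpredT (fun i => coefs u i * coefs v (n - i)%N)).
  rewrite /index_iota subn0 (big_morph Posz PoszD erefl); apply: eq_bigr => i _ /=.
  have [_ _ ->] := sP i; have [_ _ ->] := tP (n - i)%N.
  by rewrite size_allpairs PoszM.
Qed.

Lemma genfun_shift (T : eqType) (D : pred T) e k u :
  (forall x, D x -> 0 <= e x) ->
  genfun D e u -> genfun D (fun x => k%:Z + e x) (q ^+ k * u).
Proof.
move=> e_ge0 [s sP]; exists (fun n => if (n < k)%N then [::] else s (n - k)%N) => n.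
rewrite coefs_qnM; case: ltnP => [lt_nk|le_kn].
  split=> // x; rewrite in_nil; apply/esym/negP => /andP[/e_ge0]; lia.
have [us ms ->] := sP (n - k)%N; split=> // x; rewrite ms; congr (_ && _); lia.
Qed.

Lemma genfun_subst (T : eqType) (D : pred T) e k u : (0 < k)%N ->
  genfun D e u -> genfun D (fun x => k%:Z * e x) (subst k u).
Proof.
move=> k_gt0 [s sP].
exists (fun n => if (k %| n)%N then s (n %/ k)%N else [::]) => n.
rewrite /=; case: ifP => [/dvdnP[m ->]|ndiv]; last first.
  split=> // x; rewrite in_nil; apply/esym/negP => /andP[_ /eqP ke].
  by move/negP: ndiv; apply; have : (k%:Z %| n%:Z)%Z by rewrite -ke dvdz_mulr.
rewrite mulnK //; have [us ms ->] := sP m; split=> // x; rewrite ms; congr (_ && _).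
by rewrite mulnC PoszM; apply/eqP/eqP => [->//|/mulfI]; apply; lia.
Qed.

Lemma genfun_section3 (T T' : eqType) (h : T' -> T) (g : T -> T')
    (D : pred T) (D' : pred T') e e' r u :
  (forall x, D' x -> [/\ D (h x), g (h x) = x & e (h x) = 3 * e' x + r%:Z]) ->
  (forall y n, D y -> e y = 3 * n + r%:Z -> D' (g y) /\ h (g y) = y) ->
  genfun D e u -> genfun D' e' (section3 r u).
Proof.
move=> hP gP [s sP]; exists (fun n => map g (s (3 * n + r)%N)) => n.
rewrite coefs_section3; have [us ms ->] := sP (3 * n + r)%N.
have inv y : y \in s (3 * n + r)%N -> D' (g y) /\ h (g y) = y.
  by rewrite ms => /andP[Dy /eqP ey]; apply: (gP _ n%:Z); rewrite // ey; lia.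
split; last by rewrite size_map.
  by rewrite map_inj_in_uniq // => x y /inv[_ xK] /inv[_ yK] xy; rewrite -xK xy yK.
move=> x; apply/mapP/andP => [[y ys ->]|[D'x /eqP ex]].
  have [D'g yK] := inv _ ys; split=> //; have [_ _] := hP _ D'g.
  by move: ys; rewrite yK ms => /andP[_ /eqP ->]; lia.
have [Dh xK eh] := hP _ D'x; exists (h x) => //.
by rewrite ms Dh eh ex; lia.
Qed.

Definition box (n : nat) : seq int := [seq i%:Z - n%:Z | i <- iota 0 (2 * n).+1].

Lemma mem_box n (k : int) : (k \in box n) = (`|k| <= n%:Z).
Proof.
apply/mapP/idP => [[i]|k_n]; first by rewrite mem_iota => i_n ->; lia.
by exists (absz (k + n%:Z)); rewrite ?mem_iota; lia.
Qed.

Lemma box_uniq n : uniq (box n).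
Proof. by rewrite map_inj_uniq ?iota_uniq // => i j; lia. Qed.

(* The sum of [q^(e k)] over all integers [k], if [e k >= |k| - 1]. *)
Definition theta (e : int -> int) : series :=
  Series (fun n => (size [seq k <- box n.+1 | e k == n%:Z])%:Z).

Lemma genfun_theta e : (forall k, `|k| <= e k + 1) -> genfun xpredT e (theta e).
Proof.
move=> e_ge; exists (fun n => [seq k <- box n.+1 | e k == n%:Z]) => n.
split=> // [|k]; first by rewrite filter_uniq ?box_uniq.
rewrite mem_filter mem_box /=; case: eqP => //= ek.
by have := e_ge k; rewrite ek; lia.
Qed.

(** The sum over triangular numbers: 2k^2 + k is the triangular number of index 2k for k >= 0 and of
    index -2k - 1 for k < 0. Summation over all integers makes the index set a full lattice. *)
Definition psi := theta (fun k => 2 * k ^+ 2 + k).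
Definition phi := theta (fun k => k ^+ 2).
(** It collects the squares prime to 3, since (3k + 1)^2 = 3 (3k^2 + 2k) + 1. *)
Definition om := theta (fun k => 3 * k ^+ 2 + 2 * k).
Definition pent0 := theta (fun k => 6 * k ^+ 2 + k).
Definition pent1 := theta (fun k => 6 * k ^+ 2 + 7 * k + 2).
(* The sum of [q^(k(3k+1)/2)], split according to the parity of [k]. *)
Definition pent := pent0 + pent1.

Lemma genfun_psi : genfun xpredT (fun k => 2 * k ^+ 2 + k) psi.
Proof. by apply: genfun_theta => k; nia. Qed.
Lemma genfun_phi : genfun xpredT (fun k => k ^+ 2) phi.
Proof. by apply: genfun_theta => k; nia. Qed.
Lemma genfun_om : genfun xpredT (fun k => 3 * k ^+ 2 + 2 * k) om.
Proof. by apply: genfun_theta => k; nia. Qed.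
Lemma genfun_pent0 : genfun xpredT (fun k => 6 * k ^+ 2 + k) pent0.
Proof. by apply: genfun_theta => k; nia. Qed.
Lemma genfun_pent1 : genfun xpredT (fun k => 6 * k ^+ 2 + 7 * k + 2) pent1.
Proof. by apply: genfun_theta => k; nia. Qed.

Lemma psi_exponent_ge0 (k : int) : 0 <= 2 * k ^+ 2 + k.
Proof. nia. Qed.

Lemma pent1_exponent_ge0 (k : int) : 0 <= 6 * k ^+ 2 + 7 * k + 2.
Proof. by case: (lerP 0 k) => ?; nia. Qed.

(** * Theta identities from bijections of lattices *)

Lemma phi_dissection : phi = subst 9 phi + 2%:R * (q * subst 3 om).
Proof.
have g0 : genfun (fun k => (3 %| k)%Z) (fun k => k ^+ 2) (subst 9 phi).
  apply: (genfun_bij (h := fun m => 3 * m) (g := fun k => (k %/ 3)%Z))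
    (genfun_subst _ genfun_phi) => // [m _|k k3]; split; lia.
have om3 := genfun_shift 1 _ (genfun_subst (isT : (0 < 3)%N) genfun_om).
have g1 : genfun (fun k => (3 %| k - 1)%Z) (fun k => k ^+ 2) (q * subst 3 om).
  apply: (genfun_bij (h := fun m => 3 * m + 1) (g := fun k => (k %/ 3)%Z))
    (om3 _) => // [m _|k k3|k _]; [split; lia| split; lia | nia].
have g2 : genfun (fun k => (3 %| k + 1)%Z) (fun k => k ^+ 2) (q * subst 3 om).
  apply: (genfun_bij (h := fun m => - (3 * m + 1)) (g := fun k => (- k %/ 3)%Z))
    (om3 _) => // [m _|k k3|k _]; [split; lia| split; lia | nia].
apply: genfun_inj genfun_phi _; rewrite mulr_natl mulr2n addrA.
apply: genfun_split g2; last first.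
- by apply: genfun_split g0 g1 => [k|k]; [reflexivity | lia].
- by move=> k; lia.
- by move=> k; lia.
Qed.

(** For k = 3m, -3m - 2 and -3m - 1 the exponent 2k^2 + k becomes 3 (6m^2 + m), 3 (6m^2 + 7m + 2)
    and 9 (2m^2 + m) + 1. *)
Lemma psi_dissection : psi = subst 3 pent + q * subst 9 psi.
Proof.
have g0 : genfun (fun k => (3 %| k)%Z) (fun k => 2 * k ^+ 2 + k) (subst 3 pent0).
  apply: (genfun_bij (h := fun m => 3 * m) (g := fun k => (k %/ 3)%Z))
    (genfun_subst _ genfun_pent0) => // [m _|k k3]; split; lia.
have g1 : genfun (fun k => (3 %| k - 1)%Z) (fun k => 2 * k ^+ 2 + k) (subst 3 pent1).
  apply: (genfun_bij (h := fun m => - 3 * m - 2) (g := fun k => (- (k + 2) %/ 3)%Z))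
    (genfun_subst _ genfun_pent1) => // [m _|k k3]; split; lia.
have g2 : genfun (fun k => (3 %| k + 1)%Z) (fun k => 2 * k ^+ 2 + k)
                 (q * subst 9 psi).
  have psi9 := genfun_shift 1 _ (genfun_subst (isT : (0 < 9)%N) genfun_psi).
  apply: (genfun_bij (h := fun m => - 3 * m - 1) (g := fun k => (- (k + 1) %/ 3)%Z))
    (psi9 _) => // [m _|k k3|k _]; [split; lia| split; lia | nia].
apply: genfun_inj genfun_psi _; rewrite rmorphD.
apply: genfun_split g2; last first.
- by apply: genfun_split g0 g1 => [k|k]; [reflexivity | lia].
- by move=> k; lia.
- by move=> k; lia.
Qed.

Lemma genfun_pent_sqr : genfun xpredT (fun k => 3 * k ^+ 2 + k) (subst 2 pent).
Proof.
have g0 : genfun (fun k => (2 %| k)%Z) (fun k => 3 * k ^+ 2 + k) (subst 2 pent0).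
  apply: (genfun_bij (h := fun m => 2 * m) (g := fun k => (k %/ 2)%Z))
    (genfun_subst _ genfun_pent0) => // [m _|k k2]; split; lia.
have g1 : genfun (fun k => ~~ (2 %| k)%Z) (fun k => 3 * k ^+ 2 + k) (subst 2 pent1).
  apply: (genfun_bij (h := fun m => 2 * m + 1) (g := fun k => (k %/ 2)%Z))
    (genfun_subst _ genfun_pent1) => // [m _|k k2]; split; lia.
by rewrite rmorphD; apply: genfun_split g0 g1 => k; lia.
Qed.

(** The exponent is six times a triangular number and takes the same value at k and -1 - k, whence
    the factor 2. *)
Lemma genfun_double_psi6 :
  genfun xpredT (fun k => 3 * k ^+ 2 + 3 * k) (2%:R * subst 6 psi).
Proof.
have psi6 := genfun_subst (isT : (0 < 6)%N) genfun_psi.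
have g0 : genfun (fun k => (2 %| k)%Z) (fun k => 3 * k ^+ 2 + 3 * k) (subst 6 psi).
  apply: (genfun_bij (h := fun m => 2 * m) (g := fun k => (k %/ 2)%Z)) psi6
    => // [m _|k k2]; split; lia.
have g1 : genfun (fun k => ~~ (2 %| k)%Z) (fun k => 3 * k ^+ 2 + 3 * k) (subst 6 psi).
  apply: (genfun_bij (h := fun m => - 2 * m - 1) (g := fun k => (- k %/ 2)%Z)) psi6
    => // [m _|k k2]; split; lia.
by rewrite mulr_natl mulr2n; apply: genfun_split g0 g1 => k; lia.
Qed.

(** The quadratic part t^2 + 2k^2 of the exponent is the norm of t + k sqrt(-2), and k - t modulo 3
    determines the class of this element modulo 1 + sqrt(-2). Each class consists of the elements (1
    + sqrt(-2)) (b + m sqrt(-2)), up to sign and a constant, whose norm has quadratic part 3b^2 +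
    6m^2. *)
Lemma phi_psi :
  phi * psi = pent * subst 2 pent + 2%:R * (q * subst 3 psi * subst 6 psi).
Proof.
pose e (z : int * int) := z.1 ^+ 2 + (2 * z.2 ^+ 2 + z.2).
have gE : genfun xpredT e (phi * psi).
  by apply: genfunM genfun_phi genfun_psi => k _; nia.
have g0 : genfun (fun z => (3 %| z.2 - z.1)%Z) e (pent0 * subst 2 pent).
  apply: (genfun_bij (h := fun x => (x.2 - 2 * x.1, x.1 + x.2))
      (g := fun z => (((z.2 - z.1) %/ 3)%Z, z.2 - ((z.2 - z.1) %/ 3)%Z)))
    (genfunM _ _ genfun_pent0 genfun_pent_sqr); rewrite /e.
  - by case=> m b _ /=; split; [lia | congr (_, _); lia | ring].
  - by case=> t k /= d3; split=> //; congr (_, _); lia.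
  - by move=> k _; nia.
  - by move=> k _; nia.
have g1 : genfun (fun z => (3 %| z.2 - z.1 - 1)%Z) e (pent1 * subst 2 pent).
  apply: (genfun_bij (h := fun x => (2 * x.1 + 1 - x.2, - (x.1 + x.2) - 1))
      (g := fun z => ((- (z.2 - z.1 + 2) %/ 3)%Z,
                      2 * (- (z.2 - z.1 + 2) %/ 3)%Z + 1 - z.1)))
    (genfunM _ _ genfun_pent1 genfun_pent_sqr); rewrite /e.
  - by case=> m b _ /=; split; [lia | congr (_, _); lia | ring].
  - by case=> t k /= d3; split=> //; congr (_, _); lia.
  - by move=> k _; exact: pent1_exponent_ge0.
  - by move=> k _; nia.
have g2 : genfun (fun z => (3 %| z.2 - z.1 + 1)%Z) e
                 (q * subst 3 psi * (2%:R * subst 6 psi)).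
  have psi3 : genfun xpredT _ (q * _) :=
    genfun_shift 1 _ (genfun_subst (isT : (0 < 3)%N) genfun_psi).
  apply: (genfun_bij (h := fun x => (2 * x.1 - x.2, - x.1 - x.2 - 1))
      (g := fun z => ((- (z.2 - z.1 + 1) %/ 3)%Z,
                      2 * (- (z.2 - z.1 + 1) %/ 3)%Z - z.1)))
    (genfunM _ _ (psi3 _) genfun_double_psi6); rewrite /e.
  - by case=> m w _ /=; split; [lia | congr (_, _); lia | ring].
  - by case=> t k /= d3; split=> //; congr (_, _); lia.
  - by move=> k _; have := psi_exponent_ge0 k; lia.
  - by move=> k _; nia.
  - by move=> k _; have := psi_exponent_ge0 k; lia.
rewrite mulrDl [2%:R * _]mulrCA; apply: genfun_inj gE _.
apply: genfun_split g2; last first.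
- by apply: genfun_split g0 g1 => [z|[t k] /=]; [reflexivity | lia].
- by case=> t k /=; lia.
- by case=> t k /=; lia.
Qed.

(** For indices i, j of the two factors psi, put s = i + j and t = i - j, of equal parity. The total
    exponent is t^2 + s^2 + s, and s = 2k or s = -2k - 1 both give s^2 + s = 2 (2k^2 + k). *)
Lemma phi_psi2 : phi * subst 2 psi = psi ^+ 2.
Proof.
have g : genfun xpredT (fun z : int * int => (2 * z.1 ^+ 2 + z.1) + (2 * z.2 ^+ 2 + z.2))
                (psi ^+ 2).
  by rewrite expr2; apply: genfunM genfun_psi genfun_psi => k _; nia.
apply: genfun_inj _ g.
apply: (genfun_bij
  (h := fun z => if (2 %| z.1)%Z then (z.2 + (z.1 %/ 2)%Z, z.2 - (z.1 %/ 2)%Z)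
                 else ((z.1 %/ 2)%Z - z.2, - z.2 - 1 - (z.1 %/ 2)%Z))
  (g := fun z => (z.1 - z.2, if (2 %| z.1 + z.2)%Z then ((z.1 + z.2) %/ 2)%Z
                             else (- (z.1 + z.2 + 1) %/ 2)%Z)))
  (genfunM _ _ genfun_phi (genfun_subst _ genfun_psi)) => //.
- case=> t k _ /=; case: ifP => t2 /=; split=> //.
  + by case: ifP => // d2; congr (_, _); lia.
  + have [m ->] : exists m, t = 2 * m by exists (t %/ 2)%Z; lia.
    by rewrite mulKz //; ring.
  + by case: ifP => // d2; congr (_, _); lia.
  + have [m ->] : exists m, t = 2 * m + 1 by exists (t %/ 2)%Z; lia.
    by rewrite (_ : ((2 * m + 1) %/ 2)%Z = m); [ring | lia].
- by case=> i j _ /=; split=> //; case: ifP; case: ifP => ? ?; congr (_, _); lia.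
- by move=> k _; nia.
- by move=> k _; nia.
Qed.

(** An exponent that is 1 modulo 3 fixes the class of the index pair modulo 1 + sqrt(-2) or its
    conjugate; dividing by that element of norm 3 interchanges [pent0] and [pent1]. *)
Lemma section3_pent_om :
  section3 1 (pent * subst 4 om) = pent * subst 6 psi.
Proof.
have g0 : genfun xpredT (fun z : int * int =>
    (6 * z.1 ^+ 2 + z.1) + (6%:Z * (2 * z.2 ^+ 2 + z.2)))
    (section3 1 (pent1 * subst 4 om)).
  apply: (genfun_section3 (h := fun x => (x.1 - 2 * x.2 - 1, x.1 + x.2))
     (g := fun z => (z.2 - ((z.2 - z.1) %/ 3)%Z, ((z.2 - z.1) %/ 3)%Z)))
    (genfunM _ _ genfun_pent1 (genfun_subst (isT : (0 < 4)%N) genfun_om)).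
  - by case=> i j _ /=; split; [lia | congr (_, _); lia | ring].
  - case=> k l n _ /= ekl; have d3 : (3 %| l - k - 1)%Z by lia.
    by split=> //; congr (_, _); lia.
  - by move=> k _; exact: pent1_exponent_ge0.
  - by move=> k _; nia.
have g1 : genfun xpredT (fun z : int * int =>
    (6 * z.1 ^+ 2 + 7 * z.1 + 2) + (6%:Z * (2 * z.2 ^+ 2 + z.2)))
    (section3 1 (pent0 * subst 4 om)).
  apply: (genfun_section3 (h := fun x => (x.1 + 2 * x.2 + 1, x.1 - x.2))
     (g := fun z => (z.2 + ((z.1 - z.2) %/ 3)%Z, ((z.1 - z.2) %/ 3)%Z)))
    (genfunM _ _ genfun_pent0 (genfun_subst (isT : (0 < 4)%N) genfun_om)).
  - by case=> i j _ /=; split; [lia | congr (_, _); lia | ring].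
  - case=> k l n _ /= ekl; have d3 : (3 %| k - l - 1)%Z by lia.
    by split=> //; congr (_, _); lia.
  - by move=> k _; nia.
  - by move=> k _; nia.
have psi6 := genfun_subst (isT : (0 < 6)%N) genfun_psi.
rewrite !mulrDl raddfD /= addrC; congr (_ + _).
  by apply: genfun_inj g0 (genfunM _ _ genfun_pent0 psi6) => k _; nia.
apply: genfun_inj g1 (genfunM _ _ genfun_pent1 psi6) => k _; last nia.
exact: pent1_exponent_ge0.
Qed.

(** * Infinite products *)

Definition of_poly (p : {poly int}) := Series (fun n => p`_n).

Fact of_poly_is_additive : zmod_morphism of_poly.
Proof. by move=> p r; apply: seriesP => n; rewrite coefsB /= coefB. Qed.
HB.instance Definition _ :=
  GRing.isZmodMorphism.Build {poly int} series of_poly of_poly_is_additive.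
Fact of_poly_is_monoid_morphism : monoid_morphism of_poly.
Proof.
split; first by apply: seriesP => n; rewrite /= coef1.
by move=> p r; apply: seriesP => n; rewrite /= coefM.
Qed.
HB.instance Definition _ := GRing.isMonoidMorphism.Build {poly int} series
  of_poly of_poly_is_monoid_morphism.

Lemma of_polyX : of_poly 'X = q.
Proof. by apply: seriesP => n; rewrite /= coefX. Qed.

(* Meaningful only when [g i = 1 + O(q^(i + 1))]. *)
Definition infprod (g : nat -> series) :=
  Series (fun n => coefs (\prod_(i < n) g i) n).

Definition prodable (g : nat -> series) := forall i, eq_upto i (g i) 1.

Lemma infprodP g n N : prodable g -> (n <= N)%N ->
  eq_upto n (infprod g) (\prod_(i < N) g i).
Proof.
move=> g1 le_nN i le_in; have le_iN := leq_trans le_in le_nN.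
have -> : \prod_(j < N) g j = \prod_(j < i) g j * \prod_(i <= j < N) g j.
  by rewrite -!(big_mkord xpredT g) (big_cat_nat (leq0n i) le_iN).
suff tail1 : eq_upto i (\prod_(i <= j < N) g j) 1.
  rewrite -[LHS]/(coefs (\prod_(j < i) g j) i) -[X in coefs X i = _]mulr1.
  exact: (eq_upto_sym (eq_uptoM (eq_upto_refl _) tail1)).
rewrite big_nat; apply: (big_ind (eq_upto i ^~ 1)) => // [u v u1 v1|j].
  by rewrite -[1]mulr1; apply: eq_uptoM.
by case/andP=> le_ij _; apply: eq_upto_leq (g1 j).
Qed.

Lemma infprod_eqP g u : prodable g ->
  (forall n, exists2 N, (n <= N)%N & eq_upto n (\prod_(i < N) g i) u) ->
  infprod g = u.
Proof.
move=> g1 gu; apply: eq_uptoP => n; have [N le_nN] := gu n.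
exact: eq_upto_trans (infprodP g1 le_nN).
Qed.

Lemma infprodM g h : prodable g -> prodable h ->
  infprod g * infprod h = infprod (fun i => g i * h i).
Proof.
move=> g1 h1; apply/esym/infprod_eqP => [i|n].
  by rewrite -[X in eq_upto _ _ X]mulr1; apply: eq_uptoM.
exists n => //; rewrite big_split; apply: eq_uptoM; apply: eq_upto_sym; exact: infprodP.
Qed.

Lemma prodable_qn (e : nat -> nat) : (forall i, (i < e i)%N) ->
  prodable (fun i => 1 - q ^+ e i).
Proof.
move=> e_gt i; rewrite -[X in eq_upto _ _ X]subr0 -[q ^+ _]mulr1.
by apply: eq_uptoB; [apply: eq_upto_refl | apply: eq_upto_qn].
Qed.

Lemma coefs0_infprod g : coefs (infprod g) 0 = 1.
Proof. by rewrite /= big_ord0. Qed.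

Lemma eq_upto_subst k n u v : (0 < k)%N ->
  eq_upto n u v -> eq_upto n (subst k u) (subst k v).
Proof.
move=> k_gt0 uv i le_in /=; case: ifP => // _; apply: uv.
by apply: leq_trans le_in; apply: leq_div.
Qed.

Lemma eq_upto_negq n u v : eq_upto n u v -> eq_upto n (negq u) (negq v).
Proof. by move=> uv i le_in /=; rewrite uv. Qed.

Lemma infprod_morph (f : {rmorphism series -> series}) g :
  (forall n u v, eq_upto n u v -> eq_upto n (f u) (f v)) -> prodable g ->
  f (infprod g) = infprod (f \o g).
Proof.
move=> f_upto g1; apply/esym/infprod_eqP => [i|n].
  by rewrite -(rmorph1 f); apply: f_upto.
by exists n => //; rewrite /= -rmorph_prod; apply/f_upto/eq_upto_sym/infprodP.
Qed.

Definition f (k : nat) := infprod (fun i => 1 - q ^+ (k * i.+1)).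
Definition oddprod := infprod (fun i => 1 - q ^+ (2 * i).+1).

Lemma f_prodable k : (0 < k)%N -> prodable (fun i => 1 - q ^+ (k * i.+1)).
Proof. by move=> k_gt0; apply: prodable_qn => i; rewrite -{1}[i.+1]mul1n leq_mul. Qed.

Lemma oddprod_prodable : prodable (fun i => 1 - q ^+ (2 * i).+1).
Proof. by apply: prodable_qn => i; lia. Qed.

Lemma coefs_f k : coefs (f k) =1 euler_f k.
Proof.
move=> n; rewrite /euler_f -[RHS]/(coefs (of_poly _) n) big_add1 big_mkord.
rewrite rmorph_prod /=; congr (coefs _ n); apply: eq_bigr => i _.
by rewrite rmorphB rmorph1 rmorphXn /= of_polyX.
Qed.

Lemma subst_f k l : (0 < k)%N -> (0 < l)%N -> subst k (f l) = f (k * l).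
Proof.
move=> k_gt0 l_gt0; rewrite infprod_morph; last exact: f_prodable.
  congr infprod; apply: funext => i /=.
  by rewrite rmorphB rmorph1 rmorphXn /= subst_q // -exprM mulnA.
by move=> n u v; apply: eq_upto_subst.
Qed.

Lemma prod_pairs (g : nat -> series) n :
  \prod_(i < 2 * n) g i = \prod_(i < n) (g (2 * i)%N * g (2 * i).+1).
Proof.
elim: n => [|n IHn]; first by rewrite !big_ord0.
by rewrite mulnSr addn2 !big_ord_recr /= IHn mulrA.
Qed.

Lemma f1_oddprod : f 1 = f 2 * oddprod.
Proof.
rewrite infprodM; [|exact: f_prodable|exact: oddprod_prodable].
apply: infprod_eqP => [|n]; first exact: f_prodable.
exists (2 * n)%N; first by rewrite leq_pmull.
rewrite (prod_pairs (fun i => 1 - q ^+ (1 * i.+1))); apply: eq_upto_sym.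
rewrite [X in eq_upto _ _ X](eq_bigr (fun i : 'I_n =>
  (1 - q ^+ (2 * i.+1)) * (1 - q ^+ (2 * i).+1))).
  apply: infprodP => // i; rewrite -[X in eq_upto _ _ X]mulr1.
  by apply: eq_uptoM; [apply: f_prodable | apply: oddprod_prodable].
by move=> i _; rewrite mulrC !mul1n mulnSr addn2.
Qed.

(** Factor by factor, (1 - x) (1 + x) = 1 - x^2 with x = q^(2i + 1). *)
Lemma negq_oddprod : oddprod * negq oddprod = subst 2 oddprod.
Proof.
rewrite !infprod_morph; try exact: oddprod_prodable; first last.
- by move=> n u v; apply: eq_upto_negq.
- by move=> n u v; apply: eq_upto_subst.
rewrite infprodM; first last.
- move=> i; have := eq_upto_negq (@oddprod_prodable i).
  by rewrite rmorph1.
- exact: oddprod_prodable.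
congr infprod; apply: funext => i /=.
rewrite !rmorphB !rmorph1 !rmorphXn /= subst_q // negq_q exprNn -signr_odd.
by rewrite oddS oddM /= expr1 -exprM [(2 * _.+1)%N]mulnC exprM; ring.
Qed.

(** * Gauss' product for [psi] *)

Lemma genfun_eq_upto (T : eqType) (D D' : pred T) (e : T -> int) n u v :
  (forall x, e x <= n%:Z -> D x = D' x) ->
  genfun D e u -> genfun D' e v -> eq_upto n u v.
Proof.
move=> DD' [s sP] [t tP] i le_in.
have [us ms ->] := sP i; have [ut mt ->] := tP i; congr (_%:Z).
apply/perm_size/uniq_perm => // x; rewrite ms mt.
by case: eqP => [ex|]; rewrite ?andbF // DD' // ex lez_nat.
Qed.

Lemma genfun_pred1 (T : eqType) (e : T -> int) (x : T) (k : nat) :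
  e x = k%:Z -> genfun (pred1 x) e (q ^+ k).
Proof.
move=> ex; exists (fun n => if n == k then [:: x] else [::]) => n.
rewrite coefs_qn; case: eqP => [->|nk]; split=> // y.
  by rewrite inE /=; case: eqP => // ->; rewrite ex eqxx.
by rewrite in_nil; apply/esym/negP => /andP[/eqP -> /eqP]; rewrite ex; lia.
Qed.

(** The indices k and -k - 1 of [psi] are paired, so this is its partial sum over -n <= k < n. *)
Definition psi_sum n :=
  \sum_(k < n) (q ^+ (k * (2 * k).+1) + q ^+ (k.+1 * (2 * k).+1)).

Lemma eq_upto_psi n : eq_upto n psi (psi_sum n.+1).
Proof.
have gE m : genfun (fun k => (- m%:Z <= k < m%:Z)) (fun k => 2 * k ^+ 2 + k) (psi_sum m).
  elim: m => [|m IHm]; rewrite /psi_sum ?big_ord0.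
    by exists (fun _ => [::]) => n'; split=> // x; rewrite in_nil; lia.
  rewrite big_ord_recr /=; apply: genfun_split IHm _ => [x|x|]; first 2 last.
  - apply: (genfun_split (D := [pred x | (x == m%:Z) || (x == - m.+1%:Z)]));
      [reflexivity| | apply: (genfun_pred1 (x := m%:Z))
      | apply: (genfun_pred1 (x := - m.+1%:Z))];
      [move=> x /=|..]; lia.
  - by rewrite /=; lia.
  - by rewrite /=; lia.
apply: genfun_eq_upto (genfun_psi) (gE _) => x /=; nia.
Qed.

(* Shanks' identity.  With [x = q^(2n + 1)], the sum on the right telescopes
   since [B_(s+1) (1 - q^(2s+2)) = B_s (1 - q^(2s+1))] for its coefficients
   [B_s] of [x^s]. *)
Lemma shanks n :
  \prod_(i < n) (1 - q ^+ (2 * i).+1) * psi_sum n =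
  \sum_(s < n) \prod_(i < s) (1 - q ^+ (2 * i).+1)
     * \prod_(s <= i < n) (1 - q ^+ (2 * i.+1)) * q ^+ (s * (2 * n).+1).
Proof.
pose O s : series := \prod_(i < s) (1 - q ^+ (2 * i).+1).
pose P s t : series := \prod_(s <= i < t) (1 - q ^+ (2 * i.+1)).
have OS s : O s.+1 = O s * (1 - q ^+ (2 * s).+1) by rewrite /O big_ord_recr.
have PS s t : (s <= t)%N -> P s t.+1 = P s t * (1 - q ^+ (2 * t.+1)).
  by move=> le_st; rewrite /P big_nat_recr.
have PE s t : (s < t)%N -> P s t = (1 - q ^+ (2 * s.+1)) * P s.+1 t.
  by move=> lt_st; rewrite /P big_ltn.
rewrite -/(O n) -[RHS]/(\sum_(s < n) O s * P s n * q ^+ (s * (2 * n).+1)).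
elim: n => [|n IHn]; first by rewrite /psi_sum !big_ord0 mulr0.
rewrite {1}/psi_sum big_ord_recr /= -/(psi_sum n) OS.
set x := q ^+ (2 * n).+1.
have xE s : q ^+ (s * (2 * n).+1) = x ^+ s by rewrite mulnC exprM.
have telescope k : (k <= n)%N ->
    \sum_(s < k.+1) O s * P s n *
      (x ^+ s.+1 * (1 - q ^+ (2 * s).+1) - x ^+ s * (1 - q ^+ (2 * s)))
    = O k * P k n * (x ^+ k.+1 * (1 - q ^+ (2 * k).+1)).
  elim: k => [|k IHk] le_kn.
    by rewrite big_ord_recr big_ord0 /= muln0 expr0 subrr mulr0 subr0 add0r.
  rewrite big_ord_recr /= IHk ?(ltnW le_kn) // (PE k n le_kn) OS; ring.
(* Termwise, x^s q^(2s) (1 - x q) - (1 - x) x^s = x^(s+1) (1 - q^(2s+1)) - x^s (1 - q^(2s)), which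
   is the summand of [telescope]. *)
have -> : \sum_(s < n.+1) O s * P s n.+1 * q ^+ (s * (2 * n.+1).+1) =
  (1 - x) * (\sum_(s < n) O s * P s n * q ^+ (s * (2 * n).+1) + O n * x ^+ n)
  + O n * P n n * (x ^+ n.+1 * (1 - q ^+ (2 * n).+1)).
  have -> : O n * x ^+ n = O n * P n n * q ^+ (n * (2 * n).+1).
    by rewrite {1}/P big_geq // mulr1 xE.
  have -> : \sum_(s < n) O s * P s n * q ^+ (s * (2 * n).+1)
      + O n * P n n * q ^+ (n * (2 * n).+1)
    = \sum_(s < n.+1) O s * P s n * q ^+ (s * (2 * n).+1) by rewrite big_ord_recr.
  rewrite -telescope // mulr_sumr -big_split; apply: eq_bigr => [[s /=]].
  rewrite ltnS => le_sn _; rewrite PS // xE.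
  have -> : q ^+ (s * (2 * n.+1).+1) = x ^+ s * q ^+ (2 * s).
    by rewrite -xE -exprD; congr (q ^+ _); lia.
  have -> : q ^+ (2 * n.+1) = x * q by rewrite -exprSr; congr (q ^+ _); lia.
  rewrite (exprS x) (exprS q); ring.
rewrite -IHn /P big_geq // -/x xE [q ^+ (n.+1 * _)]xE exprS; ring.
Qed.

(** In the limit of [shanks] every term with s >= 1 starts beyond q^n, so only the product at s = 0
    survives. With [f1_oddprod] this is psi = f_2^2/f_1. *)
Lemma psi_oddprod : psi * oddprod = f 2.
Proof.
apply: eq_uptoP => n.
have le_n : (n <= n.+1)%N by [].
apply: eq_upto_trans (eq_uptoM (@eq_upto_psi n) (infprodP oddprod_prodable le_n)) _.
rewrite mulrC shanks big_ord_recl big_ord0 mul1r mul0n expr0 mulr1 big_mkord.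
apply: eq_upto_trans (eq_upto_sym (infprodP (f_prodable (isT : 0 < 2)%N) le_n)).
move=> i le_in; rewrite coefsD -[RHS]addr0; congr (_ + _).
rewrite (big_morph (fun u => coefs u i) (fun _ _ => erefl) erefl) big1 // => s _.
rewrite mulrC coefs_qnM ifT //.
by apply: (leq_trans _ (leq_pmull _ _)) => //; lia.
Qed.

Lemma negq_f2 : negq (f 2) = f 2.
Proof. by rewrite -(@subst_f 2 1) // negq_substE. Qed.

Lemma f2_oddprod : f 2 = f 4 * subst 2 oddprod.
Proof. by rewrite -(@subst_f 2 1) // f1_oddprod rmorphM /= subst_f. Qed.

Lemma coefs0_negq u : coefs (negq u) 0 = coefs u 0.
Proof. by rewrite /= expr0 mul1r. Qed.

(** Replacing q by -q in [phi_psi2] expresses phi(-q) through psi(-q) and psi(q^2), whose products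
    are known. The right-hand side is f_1^2/f_2. *)
Lemma negq_phi : negq phi = f 2 * oddprod ^+ 2.
Proof.
have psiN : negq psi * negq oddprod = f 2 by rewrite -rmorphM /= psi_oddprod negq_f2.
have psi2 : subst 2 psi * subst 2 oddprod = f 4.
  by rewrite -rmorphM /= psi_oddprod subst_f.
have phiN : negq phi * subst 2 psi = negq psi ^+ 2.
  by rewrite -rmorphXn -phi_psi2 rmorphM /= negq_substE.
have c0 : coefs (f 4 * negq oddprod ^+ 2) 0 = 1.
  by rewrite expr2 !coefs0M coefs0_negq !coefs0_infprod.
apply: (series_cancel c0); rewrite -{1}psi2.
transitivity (negq phi * subst 2 psi * negq oddprod ^+ 2 * subst 2 oddprod); first by ring.
rewrite phiN -exprMn psiN {1}[f 2]f2_oddprod -negq_oddprod f2_oddprod -negq_oddprod; ring.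
Qed.

(** * The generating function of [ped] *)

Definition ped_series := Series (fun n => (ped n)%:Z).

(* Expanding this product of truncated geometric series gives one monomial for
   each multiplicity function counted by [ped n]. *)
Definition ped_prod n : series :=
  \prod_(i < n) \sum_(m < n.+1 | odd i.+1 || (m <= 1)%N) q ^+ (i.+1 * m).

Lemma coefs_sum (I : Type) (r : seq I) (P : pred I) (F : I -> series) n :
  coefs (\sum_(i <- r | P i) F i) n = \sum_(i <- r | P i) coefs (F i) n.
Proof. exact: (big_morph (fun u => coefs u n) (fun _ _ => erefl) erefl). Qed.

Lemma coefs_ped_prod n : coefs (ped_prod n) n = (ped n)%:Z.
Proof.
rewrite /ped_prod bigA_distr_big_dep coefs_sum /ped -sum1_card.
rewrite (big_morph Posz PoszD erefl) [RHS]big_mkcond [LHS]big_mkcond.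
apply: eq_bigr => m _; rewrite inE -expr_sum coefs_qn eq_sym.
have -> : (m \in family (fun (i : 'I_n) (j : 'I_n.+1) => odd i.+1 || (j <= 1)%N)) =
  [forall i : 'I_n, ~~ odd i.+1 ==> (m i <= 1)%N].
  apply/familyP/forallP => m_ok i; have := m_ok i; rewrite -?topredE /=.
    by case: (odd i).
  by case: (odd i).
by rewrite andbC; case: [forall _, _]; case: (_ == _).
Qed.

(** Put x = q^(i+1). For an odd part the truncated geometric series times 1 - x is 1 up to the order
    considered; for an even part (1 + x) (1 - x) = 1 - x^2 is a factor of f_4. *)
Lemma ped_prod_f1 n : eq_upto n (ped_prod n * f 1) (f 4).
Proof.
case: n => [|n].
  by move=> i; rewrite leqn0 => /eqP ->; rewrite coefs0M !coefs0_infprod /ped_prod big_ord0.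
pose g i : series := if odd i.+1 then 1 else 1 - q ^+ (2 * i.+1).
have g1 : prodable g.
  move=> i; rewrite /g; case: ifP => _; first exact: eq_upto_refl.
  exact: f_prodable.
have <- : infprod g = f 4.
  apply: infprod_eqP => // k; exists (2 * k)%N; first by rewrite leq_pmull.
  rewrite prod_pairs; apply: eq_upto_sym.
  rewrite [X in eq_upto _ _ X](eq_bigr (fun i : 'I_k => 1 - q ^+ (4 * i.+1))).
    exact/infprodP/leqnn/f_prodable.
  move=> i _; rewrite /g !oddS oddM /= mul1r; congr (1 - q ^+ _); lia.
apply: eq_upto_trans (eq_upto_sym (infprodP g1 (leqnn n.+1))).
have f1P := infprodP (f_prodable (isT : 0 < 1)%N) (leqnn n.+1).
apply: eq_upto_trans (eq_uptoM (eq_upto_refl _) f1P) _.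
rewrite /ped_prod -big_split; apply: eq_upto_prod => i _ /=.
rewrite /g mul1n; case: ifP => odd_i.
  have -> : \sum_(m < n.+2 | odd i.+1 || (m <= 1)%N) q ^+ (i.+1 * m) =
            \sum_(m < n.+2) (q ^+ i.+1) ^+ m.
    by apply: eq_big => m; [rewrite odd_i | rewrite exprM].
  rewrite mulrC -opprB mulNr -subrX1 opprB -exprM.
  rewrite -[X in eq_upto _ _ X]subr0 -[q ^+ _]mulr1.
  apply: eq_uptoB; first exact: eq_upto_refl.
  by apply: eq_upto_qn; rewrite mulSn; lia.
rewrite /= in odd_i; rewrite big_mkcond !big_ord_recl /= odd_i big1 //.
rewrite muln0 muln1 expr0 addr0 [(2 * _)%N]mulnC exprM.
by rewrite (_ : (1 + q ^+ i.+1) * _ = 1 - (q ^+ i.+1) ^+ 2) //; ring.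
Qed.

Lemma ped_f1 : ped_series * f 1 = f 4.
Proof.
apply: eq_uptoP => n.
apply: eq_upto_trans (@ped_prod_f1 n).
apply: eq_uptoM (eq_upto_refl _) => i le_in.
rewrite /= -coefs_ped_prod.
(* Up to order [i] both products equal f_4/f_1, so [ped_prod n] serves all coefficients up to [n] at
   once. *)
have /(_ i (leqnn i)) -> // : eq_upto i (ped_prod i) (ped_prod n).
apply: (@eq_upto_cancel _ _ _ (f 1)); first exact: coefs0_infprod.
apply: eq_upto_trans (@ped_prod_f1 i) _; apply: eq_upto_sym.
exact: eq_upto_leq (@ped_prod_f1 n).
Qed.

Lemma ped_negq_psi : ped_series * negq psi = subst 2 psi.
Proof.
have psiN : negq psi * negq oddprod = f 2 by rewrite -rmorphM /= psi_oddprod negq_f2.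
have psi2 : subst 2 psi * subst 2 oddprod = f 4.
  by rewrite -rmorphM /= psi_oddprod subst_f.
have c0 : coefs (f 1 * negq oddprod) 0 = 1.
  by rewrite coefs0M coefs0_negq !coefs0_infprod.
apply: (series_cancel c0).
transitivity ((ped_series * f 1) * (negq psi * negq oddprod)); first by ring.
rewrite ped_f1 psiN f1_oddprod -psi2 -negq_oddprod; ring.
Qed.

Lemma ped_negq_phi : ped_series * subst 2 (negq phi) = psi.
Proof.
apply: (@series_cancel _ _ (f 1)); first exact: coefs0_infprod.
rewrite negq_phi rmorphM rmorphXn /= subst_f //.
transitivity ((ped_series * f 1) * f 4 * subst 2 oddprod ^+ 2); first by ring.
rewrite ped_f1 f1_oddprod [psi * _]mulrCA psi_oddprod f2_oddprod; ring.
Qed.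

(** * [ped (9n + 7)] modulo 24 *)

Lemma coefs0_psi : coefs psi 0 = 1.
Proof.
have := congr1 (coefs^~ 0%N) psi_oddprod.
by rewrite coefs0M !coefs0_infprod mulr1.
Qed.

(** Modulo 2, psi^2 = psi(q^2), which cancels in [phi_psi2]. *)
Lemma eqmods_phi : eqmods 2 phi 1.
Proof.
apply: (@eqmods_cancel _ _ _ (subst 2 psi)); first exact: coefs0_psi.
rewrite phi_psi2 mul1r; exact: eqmods_frobenius.
Qed.

Lemma negq_phi_psi : negq phi * negq psi =
  negq pent * subst 2 pent - 2%:R * (q * subst 3 (negq psi) * subst 6 psi).
Proof.
rewrite -rmorphM phi_psi !(rmorphD, rmorphM, rmorph_nat) /=.
by rewrite !negq_substE /= negq_q; ring.
Qed.

Lemma section3D r u v : section3 r (u + v) = section3 r u + section3 r v.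
Proof. exact: raddfD. Qed.

Lemma section3_1_expansion (x0 x1 x2 x3 x4 x5 : series) :
  section3 1 (subst 3 x0 + q * subst 3 x1 + q ^+ 2 * subst 3 x2
    + q ^+ 3 * subst 3 x3 + q ^+ 4 * subst 3 x4 + q ^+ 5 * subst 3 x5)
  = x1 + q * x4.
Proof.
rewrite -[subst 3 x0]mul1r -(expr0 q) -[q * subst 3 x1]/(q ^+ 1 * subst 3 x1).
rewrite 5!raddfD /= !section3_qn //=.
by rewrite -[(1 %/ 3)%N]/0%N -[(4 %/ 3)%N]/1%N mul1r expr1 add0r !addr0.
Qed.

Lemma section3_psi2_psi :
  section3 1 (subst 2 psi * negq psi ^+ 2) =
  subst 3 (negq psi) *
    (q * subst 6 psi * subst 3 (negq psi) - 2%:R * (subst 2 pent * negq pent)).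
Proof.
pose A := subst 2 pent; pose B := subst 6 psi.
pose C := negq pent; pose D := subst 3 (negq psi).
have psi2E : subst 2 psi = subst 3 A + q ^+ 2 * subst 3 B.
  rewrite {1}psi_dissection rmorphD rmorphM /= subst_q //.
  by rewrite /A /B !subst_subst.
have psiE : negq psi = subst 3 C - q * subst 3 D.
  rewrite {1}psi_dissection rmorphD rmorphM /= !negq_substE /= negq_q mulNr.
  by rewrite /D subst_subst.
have -> : subst 2 psi * negq psi ^+ 2 =
    subst 3 (A * C ^+ 2) + q * subst 3 (- 2%:R * A * C * D)
    + q ^+ 2 * subst 3 (A * D ^+ 2 + B * C ^+ 2)
    + q ^+ 3 * subst 3 (- 2%:R * B * C * D) + q ^+ 4 * subst 3 (B * D ^+ 2)
    + q ^+ 5 * subst 3 0.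
  by rewrite psi2E psiE; ring.
rewrite section3_1_expansion -/A -/B -/C -/D; ring.
Qed.

(** The factor psi(-q^3), congruent to psi(-q)^3 modulo 3, clears the denominator of G =
    psi(q^2)/psi(-q). Since -2 = 1 modulo 3, the extracted part matches [negq_phi_psi]. *)
Lemma section3_1_ped_mod3 :
  eqmods 3 (section3 1 ped_series) (subst 3 (negq psi) * negq phi).
Proof.
apply: (@eqmods_cancel _ _ _ (negq psi)).
  by rewrite coefs0_negq coefs0_psi.
have frob := eqmods_sym (eqmods_frobenius (isT : prime 3) (negq psi)).
rewrite mulrC -section3M //.
apply: eqmods_trans (eqmods_section3 1 (eqmodsM frob (eqmods_refl _ ped_series))) _.
have -> : negq psi ^+ 3 * ped_series = subst 2 psi * negq psi ^+ 2.
  by rewrite -ped_negq_psi; ring.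
rewrite section3_psi2_psi -[_ * negq phi * _]mulrA negq_phi_psi.
apply: eqmodsM; first exact: eqmods_refl.
exists (q * subst 3 (negq psi) * subst 6 psi - subst 2 pent * negq pent); ring.
Qed.

(** No square is 2 modulo 3. *)
Lemma section3_negq_phi : section3 2 (negq phi) = 0.
Proof.
rewrite phi_dissection rmorphD !rmorphM rmorph_nat /= negq_q !negq_substE /=.
have -> : subst 9 (negq phi) + 2%:R * (- q * subst 3 (negq om)) =
  q ^+ 0 * subst 3 (subst 3 (negq phi)) - q ^+ 1 * subst 3 (2%:R * negq om).
  by rewrite subst_subst // rmorphM rmorph_nat /=; ring.
by rewrite raddfB /= !section3_qn // subrr.
Qed.

Lemma ped_mod3 : eqmods 3 (section3 2 (section3 1 ped_series)) 0.
Proof.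
apply: eqmods_trans (eqmods_section3 2 section3_1_ped_mod3) _.
by rewrite section3M // section3_negq_phi mulr0; apply: eqmods_refl.
Qed.

Lemma ped_mod8 : eqmods 8 (section3 2 (section3 1 ped_series))
                          (4%:R * (pent * subst 6 psi)).
Proof.
pose al := subst 3 (subst 2 (negq phi)); pose w := subst 2 (negq om).
have phi2E : subst 2 (negq phi) = subst 3 al - 2%:R * q ^+ 2 * subst 3 w.
  rewrite {1}phi_dissection !(rmorphD, rmorphM, rmorph_nat) /= negq_q !negq_substE /=.
  by rewrite /al /w rmorphN /= subst_q // !subst_subst //; ring.
have [b alE] : eqmods 2 al 1.
  rewrite -(rmorph1 (subst 3)) -(rmorph1 (subst 2)); do 2!apply: eqmods_morph.
  exact: eqmods_trans (eqmods_negq phi) eqmods_phi.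
have [c wE] : eqmods 2 (w ^+ 2) (subst 4 om).
  apply: eqmods_trans (eqmods_frobenius (isT : prime 2) w) _.
  by rewrite /w subst_subst //; apply: eqmods_morph; apply: eqmods_negq.
set G1 := section3 1 ped_series.
(* With X = al(q^3) and Y = 2 q^2 w(q^3), G (X - Y) = psi. Multiplying by X^2 + XY + Y^2 gives X^3 G
   = psi (X^2 + XY + Y^2) + Y^3 G, where 8 divides Y^3 and X^3 is a series in q^3. *)
have G1E : al ^+ 3 * G1 = subst 3 psi * al ^+ 2 + q * (4%:R * pent * w ^+ 2)
                          + 8%:R * (q ^+ 2 * w ^+ 3 * G1).
  rewrite /G1 -section3M //.
  have -> : subst 3 (al ^+ 3) * ped_series =
    subst 3 (pent * al ^+ 2) + q * subst 3 (subst 3 psi * al ^+ 2)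
    + q ^+ 2 * subst 3 (2%:R * pent * al * w)
    + q ^+ 3 * subst 3 (2%:R * subst 3 psi * al * w)
    + q ^+ 4 * subst 3 (4%:R * pent * w ^+ 2)
    + q ^+ 5 * subst 3 (4%:R * subst 3 psi * w ^+ 2)
    + subst 3 (8%:R * q ^+ 2 * w ^+ 3) * ped_series.
    have psiE : psi = subst 3 pent + q * subst 3 (subst 3 psi).
      by rewrite {1}psi_dissection subst_subst.
    transitivity ((subst 3 pent + q * subst 3 (subst 3 psi)) *
        (subst 3 al ^+ 2 + 2%:R * q ^+ 2 * subst 3 al * subst 3 w
         + 4%:R * q ^+ 4 * subst 3 w ^+ 2)
        + subst 3 (8%:R * q ^+ 2 * w ^+ 3) * ped_series).
      rewrite -psiE -ped_negq_phi phi2E !(rmorphM, rmorphXn, rmorph_nat) /= subst_q //.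
      ring.
    ring.
  rewrite section3D section3_1_expansion section3M //; ring.
have G1_mod8 : eqmods 8 G1
    (subst 3 (psi * subst 2 (negq phi) ^+ 3) + 4%:R * (q * (pent * subst 4 om))).
  (* As al = 1 + 2b, al^4 = 1 + 8B, so multiplication by al replaces division by al^3 modulo 8. *)
  pose B := b + 3%:R * b ^+ 2 + 4%:R * b ^+ 3 + 2%:R * b ^+ 4.
  exists (al * (q ^+ 2 * w ^+ 3 * G1) + q * pent * (c + b * w ^+ 2) - B * G1).
  have -> : subst 3 (psi * subst 2 (negq phi) ^+ 3) = subst 3 psi * al ^+ 3.
    by rewrite rmorphM rmorphXn.
  have al4 : al ^+ 4 = 1 + 8%:R * B by rewrite alE /B; ring.
  have -> : 4%:R * (q * (pent * subst 4 om)) =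
    al * (q * (4%:R * pent * w ^+ 2)) - 8%:R * (q * pent * (c + b * w ^+ 2)).
    by rewrite alE wE; ring.
  transitivity (al * (al ^+ 3 * G1) - 8%:R * B * G1).
    by rewrite mulrA -exprS al4; ring.
  rewrite G1E; ring.
apply: eqmods_trans (eqmods_section3 2 G1_mod8) _.
(* The first summand is a series in q^3 and has no exponent that is 2 modulo 3. *)
rewrite raddfD /= section3_subst //= add0r !mulr_natl raddfMn /=.
rewrite -section3_pent_om; have -> u : section3 2 (q * u) = section3 1 u.
  by apply: seriesP => n; rewrite !coefs_section3 coefs_qM addnS.
exact: eqmods_refl.
Qed.

(** After multiplication by f_1 both sides are f_4 modulo 2: f_1^4 by Frobenius twice, and psi f_1
    because f_4 = G f_1 with G = psi/phi(-q^2) = psi modulo 2. *)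
Lemma eqmods_f1_cube : eqmods 2 psi (f 1 ^+ 3).
Proof.
apply: (@eqmods_cancel _ _ _ (f 1)); first exact: coefs0_infprod.
apply: eqmods_trans (_ : eqmods 2 (f 4) _).
  rewrite -ped_f1; apply: eqmodsM (eqmods_refl _ _).
  rewrite -ped_negq_phi -[X in eqmods _ _ X]mulr1.
  apply: eqmodsM; first exact: eqmods_refl.
  rewrite -(rmorph1 (subst 2)); apply: eqmods_morph.
  exact: eqmods_trans (eqmods_negq phi) eqmods_phi.
rewrite -exprSr (exprM _ 2 2) -(@subst_f 4 1) // -(@subst_subst 2 2) //.
apply: eqmods_sym; apply: eqmods_trans (eqmodsX 2 (eqmods_frobenius (isT : prime 2) (f 1))) _.
exact: eqmods_frobenius.
Qed.

(** Modulo 2, [phi_psi] reads psi = P^3. In P^3 + f_1^3 the cofactor P^2 - P f_1 + f_1^2 of P + f_1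
    has constant term 1, hence cancels. *)
Lemma eqmods_pent_f1 : eqmods 2 pent (f 1).
Proof.
have pent_cube : eqmods 2 (pent ^+ 3) psi.
  have phi_psi1 : eqmods 2 (phi * psi) psi.
    by rewrite -[X in eqmods _ _ X]mul1r; apply: eqmodsM eqmods_phi (eqmods_refl _ _).
  apply: eqmods_trans phi_psi1; rewrite exprS phi_psi.
  apply: eqmods_sym; apply: eqmods_trans (_ : eqmods 2 (pent * subst 2 pent) _).
    by eexists.
  by apply: eqmodsM (eqmods_refl _ _) (eqmods_sym (eqmods_frobenius (isT : prime 2) pent)).
have c0 : coefs (pent ^+ 2 - pent * f 1 + f 1 ^+ 2) 0 = 1.
  by rewrite !expr2 coefsD coefsB !coefs0M !coefs0_infprod.
have [w wE] : eqmods 2 (pent + f 1) 0.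
  apply: (eqmods_cancel c0); have [w wE] := eqmods_trans pent_cube eqmods_f1_cube.
  exists (f 1 ^+ 3 + w); transitivity (pent ^+ 3 + f 1 ^+ 3); first by ring.
  by rewrite wE; ring.
exists (w - f 1); rewrite mulrBr -[_ * w]add0r -wE; ring.
Qed.

Definition a_series := f 1 * f 3 ^+ 6.

Lemma coefs_a n : coefs a_series n = a n.
Proof.
have expE u e : coefs (u ^+ e) =1 fps_exp (coefs u) e.
  elim: e => [|e IHe] m //; rewrite exprS coefsM /fps_exp iterS.
  by apply: eq_bigr => i _; rewrite IHe.
rewrite coefsM /a /fps_mul; apply: eq_bigr => i _; rewrite coefs_f expE.
by congr (_ * fps_exp _ _ _); apply: funext; apply: coefs_f.
Qed.

(** f_3^6 is (f_1^3)^2 taken at q^3, which modulo 2 is psi(q^3)^2 = psi(q^6). *)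
Lemma a_mod2 : eqmods 2 a_series (pent * subst 6 psi).
Proof.
apply: eqmodsM; first exact: eqmods_sym eqmods_pent_f1.
rewrite -(@subst_f 3 1) // (exprM _ 3 2) -!rmorphXn -(@subst_subst 3 2) //.
apply: eqmods_morph; apply: eqmods_trans (eqmods_frobenius (isT : prime 2) psi).
exact: eqmodsX (eqmods_sym eqmods_f1_cube).
Qed.

(** Modulo 3 both sides vanish; modulo 8 the right side is 4 a(n), for which only the parity of a(n)
    matters. *)
Lemma ped_9n7 n : ((ped (9 * n + 7))%:Z = 12 * a n %[mod 24])%Z.
Proof.
have /eqmodsP/(_ n) := ped_mod3; have /eqmodsP/(_ n) := ped_mod8.
have /eqmodsP/(_ n) := a_mod2.
rewrite coefs_natl coefs_a !coefs_section3 coefs0 [coefs ped_series _]/=.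
have -> : (3 * (3 * n + 2) + 1)%N = (9 * n + 7)%N by lia.
lia.
Qed.

(** * Representations by [x^2 + 2 z^2] *)

Definition qform (w : int * int) : int := w.1 ^+ 2 + 2 * w.2 ^+ 2.

Definition reps (N : nat) : seq (int * int) :=
  [seq w <- [seq (x, z) | x <- box N, z <- box N] | qform w == N%:Z].

Lemma mem_reps N w : (w \in reps N) = (qform w == N%:Z).
Proof.
rewrite mem_filter; case: eqP => [wN|] //; rewrite andTb; apply/allpairsP; exists w.
by case: w wN => x z; rewrite /qform /= !mem_box => wN; split=> //; nia.
Qed.

Lemma reps_uniq N : uniq (reps N).
Proof.
by rewrite filter_uniq // allpairs_uniq ?box_uniq // => [[? ?] [? ?]].
Qed.

Lemma prime_dvdzM p (x y : int) : prime p ->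
  (p%:Z %| x * y)%Z = (p%:Z %| x)%Z || (p%:Z %| y)%Z.
Proof. by move=> p_pr; rewrite !dvdzE abszM Euclid_dvdM. Qed.

Lemma count_involution (T : eqType) (s : seq T) (P : pred T) (tau : T -> T) :
  uniq s ->
  (forall w, w \in s -> [/\ tau w \in s, P (tau w) = ~~ P w & tau (tau w) = w]) ->
  size s = (2 * count P s)%N.
Proof.
move=> us tauP; rewrite -(count_predC P s) mul2n -addnn; congr (_ + _)%N.
rewrite -!size_filter -(size_map tau (filter P s)); apply/perm_size/uniq_perm.
- exact: filter_uniq.
- rewrite map_inj_in_uniq ?filter_uniq // => x y; rewrite !mem_filter.
  move=> /andP[_ /tauP[_ _ xK]] /andP[_ /tauP[_ _ yK]] xy.
  by rewrite -xK xy yK.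
move=> w; rewrite mem_filter /=; apply/andP/mapP => [[nPw ws]|[x]].
  have [tw Ptw wK] := tauP _ ws; exists (tau w); rewrite ?wK //.
  by rewrite mem_filter tw Ptw nPw.
rewrite mem_filter => /andP[Px xs] ->; have [-> -> _] := tauP _ xs.
by rewrite negbK.
Qed.

(** The map w -> -w is paired against a half-plane; m > 0 excludes its fixed point 0. *)
Lemma reps_even m : (0 < m)%N -> (2 %| size (reps m))%N.
Proof.
move=> m_gt0.
rewrite (@count_involution _ _ (fun w => (0 < w.1) || ((w.1 == 0) && (0 < w.2)))
  (fun w => (- w.1, - w.2)) (reps_uniq m)) ?dvdn_mulr //.
case=> x z; rewrite !mem_reps /qform /= !sqrrN => /eqP wm; split; last by rewrite !opprK.
  by apply/eqP.
have : (x != 0) || (z != 0).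
  apply/contraT; rewrite negb_or !negbK => /andP[/eqP x0 /eqP z0].
  by move: wm; rewrite x0 z0; lia.
lia.
Qed.

Section SplitPrime.
Variables (p : nat) (u v : int).
Hypotheses (p_prime : prime p) (p_odd : odd p) (pE : p%:Z = u ^+ 2 + 2 * v ^+ 2).

Let p_neq0 : p%:Z != 0 :> int. Proof. by have := prime_gt0 p_prime; lia. Qed.

Let p_ndvd2 : (p%:Z %| 2)%Z = false.
Proof.
apply/negP; rewrite dvdzE /= => /dvdn_leq; have := prime_gt1 p_prime; lia.
Qed.

(* The representations of [p N] divisible by [u + v sqrt(-2)]. *)
Lemma count_divisible N :
  count (fun w => (p%:Z %| u * w.1 + 2 * v * w.2)%Z) (reps (p * N)) = size (reps N).
Proof.
(* In Z[sqrt(-2)], [mul w] is (u + v sqrt(-2)) w, and [s w] and [t w] are the coordinates of (u - v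
   sqrt(-2)) w. *)
pose mul w := (u * w.1 - 2 * v * w.2, u * w.2 + v * w.1).
pose s w := u * w.1 + 2 * v * w.2; pose t w := u * w.2 - v * w.1.
have s_mul w : s (mul w) = p%:Z * w.1 by rewrite /s /mul pE /=; ring.
have t_mul w : t (mul w) = p%:Z * w.2 by rewrite /t /mul pE /=; ring.
have mul_inj : injective mul.
  move=> [x z] [x' z'] e; have := s_mul (x, z); have := t_mul (x, z).
  by rewrite e s_mul t_mul => /(mulfI p_neq0) /= -> /(mulfI p_neq0) /= ->.
have norm w : s w ^+ 2 + 2 * t w ^+ 2 = p%:Z * qform w by rewrite /s /t /qform pE; ring.
have form_mul w : qform (mul w) = p%:Z * qform w by rewrite /mul /qform pE /=; ring.
rewrite -size_filter -(size_map mul (reps N)); apply/perm_size/uniq_perm.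
- by rewrite filter_uniq ?reps_uniq.
- by rewrite map_inj_uniq ?reps_uniq.
move=> w; rewrite mem_filter mem_reps; apply/andP/mapP => [[/dvdzP[a sE] /eqP wN]|[y]].
  (* As s^2 + 2t^2 = p (p N), divisibility of s by p passes to t. *)
  have [b tE] : exists b, t w = b * p%:Z.
    apply/dvdzP; have : (p%:Z %| 2 * (t w * t w))%Z.
      have -> : 2 * (t w * t w) = p%:Z * (p%:Z * N%:Z) - s w ^+ 2.
        by rewrite -PoszM -wN -norm; ring.
      by rewrite /s sE; apply/dvdzP; exists (p%:Z * N%:Z - a ^+ 2 * p%:Z); ring.
    by rewrite !prime_dvdzM // p_ndvd2 orbb.
  exists (a, b).
    rewrite mem_reps; apply/eqP/(mulfI p_neq0)/(mulfI p_neq0).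
    rewrite (_ : p%:Z * N%:Z = qform w) -?(norm w); last by rewrite wN PoszM.
    rewrite /s sE tE /qform /=; ring.
  case: w wN sE tE => x z _; rewrite /s /t /mul /= => sE tE.
  congr (_, _); apply: (mulfI p_neq0).
    transitivity (u * (a * p%:Z) - 2 * v * (b * p%:Z)); last by ring.
    by rewrite -sE -tE pE; ring.
  transitivity (u * (b * p%:Z) + v * (a * p%:Z)); last by ring.
  by rewrite -sE -tE pE; ring.
rewrite mem_reps => /eqP yN ->; rewrite -/(s (mul y)) s_mul dvdz_mulr //.
by rewrite form_mul yN PoszM.
Qed.
End SplitPrime.

Section HeckeSplit.
Variables (p : nat) (u v : int).
Hypotheses (p_prime : prime p) (p_odd : odd p) (pE : p%:Z = u ^+ 2 + 2 * v ^+ 2).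

(** Inclusion-exclusion: every representation of p N is divisible by u + v sqrt(-2) or by its
    conjugate, and by both exactly when p divides both coordinates; these last ones come from
    N/p. *)
Lemma reps_hecke N :
  (size (reps (p * N)) + (if p %| N then size (reps (N %/ p)) else 0)
   = 2 * size (reps N))%N.
Proof.
have p_gt1 := prime_gt1 p_prime.
have p_neq0 : p%:Z != 0 :> int by lia.
have p_ndvd2 : (p%:Z %| 2)%Z = false.
  by apply/negP; rewrite dvdzE /= => /dvdn_leq; lia.
pose A (w : int * int) := (p%:Z %| u * w.1 + 2 * v * w.2)%Z.
pose B (w : int * int) := (p%:Z %| u * w.1 + 2 * (- v) * w.2)%Z.
have pE' : p%:Z = u ^+ 2 + 2 * (- v) ^+ 2 by rewrite sqrrN.
have cA : count A (reps (p * N)) = size (reps N) by apply: count_divisible.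
have cB : count B (reps (p * N)) = size (reps N) by apply: count_divisible.
rewrite mul2n -addnn -{1}cA -cB -count_predUI; congr (_ + _)%N.
  rewrite -[LHS]count_predT; apply: eq_in_count => w; rewrite mem_reps => /eqP wN.
  apply/esym; rewrite /= /A /B -prime_dvdzM //.
  (* (ux + 2vz) (ux - 2vz) = u^2 (x^2 + 2z^2) - 2 p z^2. *)
  apply/dvdzP; exists (u ^+ 2 * N%:Z - 2 * w.2 ^+ 2).
  transitivity (u ^+ 2 * qform w - 2 * w.2 ^+ 2 * p%:Z); first by rewrite pE /qform; ring.
  by rewrite wN PoszM; ring.
have ndvd_uv : ~~ ((p%:Z %| u)%Z && (p%:Z %| v)%Z).
  apply/negP => /andP[/dvdzP[a uE] /dvdzP[b vE]].
  have : (p%:Z * 1 = p%:Z * (p%:Z * (a ^+ 2 + 2 * b ^+ 2))) by rewrite mulr1 {1}pE uE vE; ring.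
  move/(mulfI p_neq0) => h; suff : (p%:Z %| 1)%Z by rewrite dvdzE dvdn1; lia.
  by apply/dvdzP; exists (a ^+ 2 + 2 * b ^+ 2); rewrite mulrC.
have dvd_u : (p%:Z %| u)%Z -> (p%:Z %| v)%Z.
  move=> pu; have : (p%:Z %| 2 * (v * v))%Z.
    have -> : 2 * (v * v) = p%:Z - u * u by rewrite pE; ring.
    by rewrite rpredB // dvdz_mulr.
  by rewrite !prime_dvdzM // p_ndvd2 orbb.
have dvd_v : (p%:Z %| v)%Z -> (p%:Z %| u)%Z.
  move=> pv; have : (p%:Z %| u * u)%Z.
    have -> : u * u = p%:Z - v * (2 * v) by rewrite pE; ring.
    by rewrite rpredB // dvdz_mulr.
  by rewrite !prime_dvdzM // orbb.
have ndvd_u : (p%:Z %| u)%Z = false.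
  by apply/negP => pu; move: ndvd_uv; rewrite pu dvd_u.
have ndvd_v : (p%:Z %| v)%Z = false.
  by apply/negP => pv; move: ndvd_uv; rewrite pv dvd_v.
have AB w : predI A B w -> (p%:Z %| w.1)%Z && (p%:Z %| w.2)%Z.
  move=> /andP[Aw Bw].
  have : (p%:Z %| 2 * (u * w.1))%Z.
    have -> : 2 * (u * w.1) = (u * w.1 + 2 * v * w.2) + (u * w.1 + 2 * (- v) * w.2) by ring.
    exact: rpredD.
  have : (p%:Z %| 2 * (2 * (v * w.2)))%Z.
    have -> : 2 * (2 * (v * w.2)) = (u * w.1 + 2 * v * w.2) - (u * w.1 + 2 * (- v) * w.2) by ring.
    exact: rpredB.
  by rewrite !prime_dvdzM // p_ndvd2 ndvd_u ndvd_v /= => -> ->.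
case: ifP => [/dvdnP[M NE]|pN].
  rewrite NE mulnK ?(ltnW p_gt1) // -size_filter.
  pose scale (w : int * int) := (p%:Z * w.1, p%:Z * w.2).
  have form_scale w : qform (scale w) = p%:Z * (p%:Z * qform w) by rewrite /qform /=; ring.
  rewrite -(size_map scale); apply/perm_size/uniq_perm; first last.
  - move=> w; rewrite mem_filter mem_reps; apply/mapP/andP => [[y]|[/AB]].
      rewrite mem_reps => /eqP yM ->; rewrite form_scale yM !PoszM; split; last first.
        by apply/eqP; ring.
      apply/andP; split; apply/dvdzP; [exists (u * y.1 + 2 * v * y.2)
        | exists (u * y.1 + 2 * (- v) * y.2)]; rewrite /=; ring.
    case/andP => /dvdzP[a aE] /dvdzP[b bE] /eqP wN; exists (a, b).
      rewrite mem_reps; apply/eqP/(mulfI p_neq0)/(mulfI p_neq0).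
      by rewrite -form_scale /scale /= ![p%:Z * _]mulrC -aE -bE -[LHS]/(qform w) wN !PoszM; ring.
    by case: w aE bE {wN} => x z /= -> ->; rewrite /scale /= ![p%:Z * _]mulrC.
  - by rewrite filter_uniq ?reps_uniq.
  - rewrite map_inj_uniq ?reps_uniq // => [[x z] [x' z']] [].
    by move=> /(mulfI p_neq0) -> /(mulfI p_neq0) ->.
apply/esym/eqP; rewrite -leqn0 leqNgt -has_count; apply/negP => /hasP[w].
rewrite mem_reps => /eqP wN /AB/andP[/dvdzP[a aE] /dvdzP[b bE]].
move/negP: pN; apply; have : (p%:Z %| N%:Z)%Z; last by rewrite dvdzE.
apply/dvdzP; exists (a ^+ 2 + 2 * b ^+ 2); apply: (mulfI p_neq0).
by rewrite -PoszM -wN /qform aE bE; ring.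
Qed.

(** [reps_hecke] is a recurrence of order two, r(e + 2) = 2 r(e + 1) - r(e), so two consecutive
    exponents are carried through the induction. *)
Lemma reps_split_pow e m : ~~ (p %| m)%N ->
  size (reps (p ^ e * m)) = (e.+1 * size (reps m))%N.
Proof.
move=> pm; have p_gt0 := prime_gt0 p_prime.
suff : size (reps (p ^ e * m)) = (e.+1 * size (reps m))%N /\
       size (reps (p ^ e.+1 * m)) = (e.+2 * size (reps m))%N by case.
elim: e => [|e [IH1 IH2]].
  rewrite expn0 !mul1n expn1; split=> //.
  by have := reps_hecke m; rewrite (negPf pm) addn0.
split=> //; have := reps_hecke (p ^ e.+1 * m).
have -> : (p %| p ^ e.+1 * m)%N by rewrite expnS -mulnA dvdn_mulr.
have -> : ((p ^ e.+1 * m) %/ p = p ^ e * m)%N by rewrite expnS -mulnA mulKn.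
by rewrite mulnA -expnS IH1 IH2; lia.
Qed.
End HeckeSplit.

(** For a prime p this says that -2 is not a square modulo p; a root s would give the counterexample
    w = (s, 1). *)
Definition inert (p : nat) :=
  forall w, (p%:Z %| qform w)%Z -> (p%:Z %| w.1)%Z && (p%:Z %| w.2)%Z.

Lemma reps_inert_sqr p N : (0 < p)%N -> inert p ->
  size (reps (p ^ 2 * N)) = size (reps N).
Proof.
move=> p_gt0 p_inert; have p_neq0 : p%:Z != 0 :> int by lia.
pose scale (w : int * int) := (p%:Z * w.1, p%:Z * w.2).
have form_scale w : qform (scale w) = p%:Z * (p%:Z * qform w) by rewrite /qform /=; ring.
rewrite -[RHS](size_map scale); apply/perm_size/uniq_perm; first exact: reps_uniq.
  rewrite map_inj_uniq ?reps_uniq // => [[x z] [x' z']] [].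
  by move=> /(mulfI p_neq0) -> /(mulfI p_neq0) ->.
move=> w; rewrite mem_reps; apply/eqP/mapP => [wN|[y]]; last first.
  by rewrite mem_reps => /eqP yN ->; rewrite form_scale yN !PoszM; ring.
have /p_inert/andP[/dvdzP[a aE] /dvdzP[b bE]] : (p%:Z %| qform w)%Z.
  by rewrite wN dvdzE /= -mulnA dvdn_mulr.
exists (a, b); last by case: w aE bE {wN} => x z /= -> ->; rewrite /scale /= ![p%:Z * _]mulrC.
rewrite mem_reps; apply/eqP/(mulfI p_neq0)/(mulfI p_neq0).
by rewrite -form_scale /scale /= ![p%:Z * _]mulrC -aE -bE -[LHS]/(qform w) wN !PoszM; ring.
Qed.

(** Removing factors p^2 descends to p m, where p dividing both coordinates would force p to divide
    m. *)
Lemma reps_inert_odd p e m : (0 < p)%N -> inert p -> ~~ odd e -> ~~ (p %| m)%N ->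
  size (reps (p ^ e.+1 * m)) = 0%N.
Proof.
move=> p_gt0 p_inert e_even pm.
rewrite -(odd_double_half e) (negPf e_even) add0n; elim: (e./2) => [|k IHk].
  rewrite double0 expn1; case repsE: (reps (p * m)) => [//|w s].
  have : w \in reps (p * m) by rewrite repsE mem_head.
  rewrite mem_reps => /eqP wN; have : (p%:Z %| qform w)%Z by rewrite wN dvdzE /= dvdn_mulr.
  move=> /p_inert/andP[/dvdzP[a aE] /dvdzP[b bE]]; case/negP: pm.
  suff : (p%:Z %| m%:Z)%Z by rewrite dvdzE.
  apply/dvdzP; exists (a ^+ 2 + 2 * b ^+ 2).
  apply: (mulfI (_ : p%:Z != 0)); first by lia.
  by rewrite -PoszM -wN /qform aE bE; ring.
rewrite (_ : p ^ k.+1.*2.+1 * m = p ^ 2 * (p ^ k.*2.+1 * m))%N ?reps_inert_sqr //.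
by rewrite mulnA -expnD; congr (p ^ _ * m)%N; lia.
Qed.

(** * Primes of the form u^2 + 2v^2 *)

Lemma sqrt_floor n : exists r, (r * r <= n < r.+1 * r.+1)%N.
Proof.
elim: n => [|n [r /andP[le_rn lt_nr]]]; first by exists 0%N.
have [lt|le] := ltnP n.+1 (r.+1 * r.+1); first by exists r; rewrite lt andbT ltnW.
by exists r.+1; rewrite le /=; nia.
Qed.

(* Thue's pigeonhole argument. *)
Lemma split_form p (s : int) : prime p -> odd p -> (p%:Z %| s ^+ 2 + 2)%Z ->
  exists u v : int, p%:Z = u ^+ 2 + 2 * v ^+ 2.
Proof.
move=> p_pr p_odd ps; have p_gt1 := prime_gt1 p_pr.
have [r /andP[le_rp lt_pr]] := sqrt_floor p.
(* A prime is not a square; the strict inequality is what excludes the multiplier k = 3 below. *)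
have lt_rp : (r * r < p)%N.
  rewrite ltn_neqAle le_rp andbT; apply/eqP => rp.
  have /(primeP p_pr).2/orP[/eqP r1|/eqP rpE] : (r %| p)%N by rewrite -rp dvdn_mulr.
    by rewrite r1 in rp; lia.
  by rewrite rpE in rp; nia.
(* The (r + 1)^2 > p pairs (x, y) cannot all have distinct residues x + s y modulo p. *)
pose h (z : 'I_r.+1 * 'I_r.+1) : 'I_p :=
  Ordinal (ltn_pmod (absz ((z.1%:Z + s * z.2%:Z) %% p%:Z)%Z) (ltnW p_gt1)).
have /injectivePn[[x y] [[x' y'] ne_xy h_xy]] : ~~ injectiveb h.
  apply/negP => /injectiveP/leq_card; rewrite card_prod !card_ord; lia.
have {h_xy} : (p%:Z %| (x%:Z - x'%:Z) + s * (y%:Z - y'%:Z))%Z.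
  have := congr1 val h_xy; rewrite /= !modn_small; first 1 last.
  - by rewrite -ltz_nat gez0_abs ?modz_ge0 ?ltz_pmod; lia.
  - by rewrite -ltz_nat gez0_abs ?modz_ge0 ?ltz_pmod; lia.
  move/(congr1 Posz); rewrite !gez0_abs ?modz_ge0 //; try lia.
  move/eqP; rewrite eqz_mod_dvd.
  by rewrite (_ : _ - _ = (x%:Z - x'%:Z) + s * (y%:Z - y'%:Z)) //; ring.
set a := x%:Z - x'%:Z; set b := y%:Z - y'%:Z => /dvdzP[c abE].
have [le_a le_b] : `|a| <= r%:Z /\ `|b| <= r%:Z.
  by have := ltn_ord x; have := ltn_ord x'; have := ltn_ord y; have := ltn_ord y'; lia.
have ab0 : (a != 0) || (b != 0).
  apply: contraR ne_xy; rewrite negb_or !negbK => /andP[/eqP a0 /eqP b0].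
  by apply/eqP; congr (_, _); apply: val_inj => /=; lia.
have /dvdzP[k kE] : (p%:Z %| a ^+ 2 + 2 * b ^+ 2)%Z.
  have aE : a = c * p%:Z - s * b by rewrite -abE; ring.
  have -> : a ^+ 2 + 2 * b ^+ 2 = p%:Z * (c ^+ 2 * p%:Z - 2 * c * s * b) + (s ^+ 2 + 2) * b ^+ 2.
    by rewrite aE; ring.
  by rewrite rpredD // ?dvdz_mulr // dvdz_mull.
have [a_r b_r] : a ^+ 2 <= (r * r)%N%:Z /\ b ^+ 2 <= (r * r)%N%:Z by nia.
have ab_gt0 : 0 < a ^+ 2 + 2 * b ^+ 2.
  have := sqr_ge0 a; have := sqr_ge0 b.
  case/orP: ab0 => [a0|b0].
    by have : 0 < a ^+ 2 by [rewrite exprn_even_gt0 ?a0|]; lia.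
  by have : 0 < b ^+ 2 by [rewrite exprn_even_gt0 ?b0|]; lia.
have p_gt0 : 0 < p%:Z by lia.
(* Here k p = a^2 + 2b^2 <= 3 r^2 < 3p. *)
have [k_gt0 k_lt3] : 0 < k /\ k < 3.
  split; first by rewrite -(pmulr_lgt0 _ p_gt0) -kE.
  rewrite -(ltr_pM2r p_gt0) -kE; move: lt_rp a_r b_r; rewrite -ltz_nat.
  by set R := (r * r)%N; lia.
have [k1|k2] : k = 1 \/ k = 2 by lia.
  by exists a, b; rewrite kE k1 mul1r.
(* In the case k = 2, a is even, and a = 2d turns 2p = a^2 + 2b^2 into p = b^2 + 2d^2. *)
have [d aE] : exists d, a = 2 * d.
  exists (a %/ 2)%Z; have : (2 %| a * a)%Z.
    by apply/dvdzP; exists (p%:Z - b ^+ 2); move: kE; rewrite k2; lia.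
  by rewrite (@prime_dvdzM 2) //; lia.
exists b, d; apply: (mulfI (_ : 2 != 0 :> int)) => //.
by transitivity (k * p%:Z); [rewrite k2 | rewrite -kE aE; ring].
Qed.

Lemma split_or_inert p : prime p -> odd p ->
  (exists u v : int, p%:Z = u ^+ 2 + 2 * v ^+ 2) \/ inert p.
Proof.
move=> p_pr p_odd.
have [[s ps]|no_root] := pselect (exists s : int, (p%:Z %| s ^+ 2 + 2)%Z).
  by left; apply: split_form ps.
right=> w pw.
have [pz|pz] := boolP (p%:Z %| w.2)%Z.
  rewrite andbT; have : (p%:Z %| w.1 * w.1)%Z; last by rewrite prime_dvdzM // orbb.
  have -> : w.1 * w.1 = qform w - w.2 * (2 * w.2) by rewrite /qform; ring.
  by rewrite rpredB // dvdz_mulr.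
(* [j] inverts [w.2] modulo p, so [w.1 * j] is a square root of -2. *)
case: no_root; have /coprimezP[[i j] /= ijE] : coprimez p%:Z w.2.
  by rewrite /coprimez /gcdz /=; move: pz; rewrite dvdzE /= -prime_coprime.
exists (w.1 * j).
have -> : (w.1 * j) ^+ 2 + 2 = qform w * j ^+ 2 + p%:Z * (2 * i * (2 - i * p%:Z)).
  have -> : qform w * j ^+ 2 = (w.1 * j) ^+ 2 + 2 * (j * w.2) ^+ 2 by rewrite /qform; ring.
  have -> : j * w.2 = 1 - i * p%:Z by rewrite -ijE; ring.
  ring.
by rewrite rpredD // dvdz_mulr.
Qed.

(** Modulo 3, x^2 - z^2 = 1 makes z, but not x, divisible by 3; modulo 8, x^2 + 2z^2 = 3 makes both
    odd. *)
Lemma reps_residues n x z : qform (x, z) = (24 * n + 19)%N%:Z ->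
  [/\ (x %% 6 == 1)%Z || (x %% 6 == 5)%Z & (z %% 12 == 3)%Z || (z %% 12 == 9)%Z].
Proof.
rewrite /qform /= => xzE.
have [x' [r [xr r_lt]]] : exists x' r, x = 3 * x' + r /\ (0 <= r < 3).
  by exists (x %/ 3)%Z, (x %% 3)%Z; lia.
have [z' [t [zt t_lt]]] : exists z' t, z = 3 * z' + t /\ (0 <= t < 3).
  by exists (z %/ 3)%Z, (z %% 3)%Z; lia.
have [t0 r0] : t = 0 /\ r <> 0.
  move: xzE; rewrite xr zt.
  have [-> | [-> | ->]] : r = 0 \/ r = 1 \/ r = 2 by lia.
  - have [-> | [-> | ->]] : t = 0 \/ t = 1 \/ t = 2 by lia.
    + lia.
    + lia.
    + lia.
  - have [-> | [-> | ->]] : t = 0 \/ t = 1 \/ t = 2 by lia.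
    + lia.
    + lia.
    + lia.
  - have [-> | [-> | ->]] : t = 0 \/ t = 1 \/ t = 2 by lia.
    + lia.
    + lia.
    + lia.
have [x1 xo] : exists x1, x = 2 * x1 + 1.
  exists (x %/ 2)%Z; have : (x %% 2)%Z = 0 \/ (x %% 2)%Z = 1 by lia.
  case=> [x_even|]; last lia.
  have xE : x = 2 * (x %/ 2)%Z by lia.
  by move: xzE; rewrite xE; lia.
have [z1 zo] : exists z1, z = 2 * z1 + 1.
  exists (z %/ 2)%Z; have : (z %% 2)%Z = 0 \/ (z %% 2)%Z = 1 by lia.
  case=> [z_even|]; last lia.
  have zE : z = 2 * (z %/ 2)%Z by lia.
  have [m mE] : exists m, x1 * (x1 + 1) = 2 * m.
    by exists ((x1 * (x1 + 1)) %/ 2)%Z; nia.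
  by move: xzE; rewrite zE xo; lia.
by clear xzE; split; lia.
Qed.

(** * The parity of [a] and the main theorem *)

Lemma genfun_pent : genfun xpredT (fun k => ((k * (3 * k + 1)) %/ 2)%Z) pent.
Proof.
have g0 : genfun (fun k => (2 %| k)%Z) (fun k => ((k * (3 * k + 1)) %/ 2)%Z) pent0.
  apply: (genfun_bij (h := fun m => 2 * m) (g := fun k => (k %/ 2)%Z)) genfun_pent0
    => [m _|k k2]; split; lia.
have g1 : genfun (fun k => ~~ (2 %| k)%Z) (fun k => ((k * (3 * k + 1)) %/ 2)%Z) pent1.
  apply: (genfun_bij (h := fun m => 2 * m + 1) (g := fun k => (k %/ 2)%Z)) genfun_pent1
    => [m _|k k2]; split; lia.
by apply: genfun_split g0 g1 => k; lia.
Qed.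

(** An exponent n with indices i, j satisfies 24n + 19 = (6i + 1)^2 + 2 (3 (4j + 1))^2. By
    [reps_residues] exactly one of x, -x is 1 modulo 6 and exactly one of z, -z is 3 modulo 12, so
    the sign changes account for the factor 4. *)
Lemma coefs_pent_psi6 n :
  4 * coefs (pent * subst 6 psi) n = (size (reps (24 * n + 19)))%:Z.
Proof.
pose N := (24 * n + 19)%N; rewrite -/N.
have e1_ge0 (k : int) : 0 <= ((k * (3 * k + 1)) %/ 2)%Z by rewrite divz_ge0 //; nia.
have e2_ge0 (k : int) : 0 <= 6%:Z * (2 * k ^+ 2 + k) by have := psi_exponent_ge0 k; lia.
have [s /(_ n)[us ms ->]] := genfunM (fun k _ => e1_ge0 k) (fun k _ => e2_ge0 k)
  genfun_pent (genfun_subst (isT : (0 < 6)%N) genfun_psi).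
pose P1 (w : int * int) := (w.1 %% 6 == 1)%Z.
pose P2 (w : int * int) := (w.2 %% 12 == 3)%Z.
have res w : w \in reps N -> [/\ (w.1 %% 6 == 1)%Z || (w.1 %% 6 == 5)%Z
                             & (w.2 %% 12 == 3)%Z || (w.2 %% 12 == 9)%Z].
  by case: w => x z; rewrite mem_reps => /eqP/reps_residues.
rewrite (@count_involution _ (reps N) P1 (fun w => (- w.1, w.2)) (reps_uniq N)); last first.
  move=> w wN; have [r1 _] := res w wN; move: wN; rewrite !mem_reps /qform /P1 /= sqrrN => ->.
  by split=> //; [lia | case: w {r1} => x z /=; rewrite opprK].
rewrite -size_filter.
rewrite (@count_involution _ (filter P1 (reps N)) P2 (fun w => (w.1, - w.2))
  (filter_uniq P1 (reps_uniq N))); last first.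
  move=> w; rewrite !(mem_filter P1) => /andP[P1w wN]; have [_ r2] := res w wN.
  move: wN P1w; rewrite !mem_reps /qform /P1 /P2 /= sqrrN => -> ->.
  by split=> //; [lia | case: w {r2} => x z /=; rewrite opprK].
rewrite -size_filter mulnA PoszM; congr (_ * Posz _).
rewrite -(size_map (fun ij : int * int => (6 * ij.1 + 1, 3 * (4 * ij.2 + 1))) (s n)).
apply/perm_size/uniq_perm.
- by rewrite map_inj_uniq // => [[i j] [i' j'] [? ?]]; congr (_, _); lia.
- exact/filter_uniq/filter_uniq/reps_uniq.
move=> [x z]; rewrite (mem_filter P2) (mem_filter P1) mem_reps /P1 /P2 /qform.
have eE (i j : int) : (6 * i + 1) ^+ 2 + 2 * (3 * (4 * j + 1)) ^+ 2
    = 24 * ((i * (3 * i + 1)) %/ 2)%Z + 24 * (6 * (2 * j ^+ 2 + j)) + 19.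
  have [m mE] : exists m, i * (3 * i + 1) = 2 * m.
    have [h [-> | ->]] : exists h, i = 2 * h \/ i = 2 * h + 1 by exists (i %/ 2)%Z; lia.
      by exists (h * (6 * h + 1)); ring.
    by exists ((2 * h + 1) * (3 * h + 2)); ring.
  rewrite mE mulKz //; transitivity (12 * (i * (3 * i + 1)) + 24 * (6 * (2 * j ^+ 2 + j)) + 19).
    by ring.
  by rewrite mE; ring.
apply/mapP/and3P => [[[i j]]|[/= z12 x6 /eqP xzN]].
  by rewrite ms /= => /eqP ijn [-> ->]; split; [lia|lia|rewrite eE /N; lia].
exists ((x %/ 6)%Z, (z %/ 12)%Z); last by congr (_, _) => /=; lia.
rewrite ms /=; apply/eqP.
have := eE (x %/ 6)%Z (z %/ 12)%Z.
have -> : 6 * (x %/ 6)%Z + 1 = x by lia.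
have -> : 3 * (4 * (z %/ 12)%Z + 1) = z by lia.
by rewrite xzN /N; lia.
Qed.

(** Hence a(n) is even exactly when 8 divides the number of representations of 24n + 19. *)
Lemma a_reps n :
  exists2 c : nat, (2 %| a n - c%:Z)%Z & (4 * c)%N = size (reps (24 * n + 19)).
Proof.
have := coefs_pent_psi6 n; have /eqmodsP/(_ n) := a_mod2; rewrite coefs_a.
set c := coefs _ n => a_c c_reps; exists (absz c); last by lia.
by have -> : (absz c)%:Z = c by lia.
Qed.

Lemma reps19 : size (reps 19) = 4%N. Proof. by vm_compute. Qed.

(** If p splits, the count is (4k + 4) R(m) with R(m) even, a multiple of 8; if p is inert, the odd
    exponent leaves no representation. *)
Lemma a_even p k m n : prime p -> odd p -> ~~ (p %| m)%N ->
  (24 * n + 19)%N = (p ^ (4 * k + 3) * m)%N -> (2 %| a n)%Z.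
Proof.
move=> p_pr p_odd pm nE; have [c ac] := a_reps n; rewrite nE.
have [[u [v pE]]|p_inert] := split_or_inert p_pr p_odd.
  rewrite (reps_split_pow p_pr p_odd pE) //.
  have /dvdnP[h ->] : (2 %| size (reps m))%N by apply: reps_even; case: m pm {nE}; rewrite ?dvdn0.
  move=> cE; have {}cE : c = (2 * ((k + 1) * h))%N by lia.
  by rewrite cE in ac; lia.
rewrite addnS reps_inert_odd ?prime_gt0 //; last by rewrite oddD oddM.
by move=> c0; lia.
Qed.

(** 19 = 1^2 + 2 3^2 splits, and the exponent 4k + 2 multiplies the count by the odd number 4k +
    3. *)
Lemma a_19 k m n : ~~ (19 %| 24 * n + 19)%N ->
  (24 * m + 19)%N = (19 ^ (4 * k + 2) * (24 * n + 19))%N -> (2 %| a m - a n)%Z.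
Proof.
move=> n19 mE; have [c ac cE] := a_reps m; have [d ad dE] := a_reps n.
move: cE; rewrite mE (@reps_split_pow 19 1 3) // -dE => cE.
have {cE} : c = (2 * ((2 * k + 1) * d) + d)%N by lia.
lia.
Qed.

Lemma legendre_odd (x : int) p : ~~ (p%:Z %| x)%Z ->
  legendre x p = 1 \/ legendre x p = -1.
Proof. by rewrite /legendre => /negPf ->; case: ifP; [left | right]. Qed.

Section Main.
Variable p : nat.
Hypotheses (p_prime : prime p) (p_ge5 : (5 <= p)%N).

Lemma odd_p : odd p.
Proof. by have [p2|] := even_prime p_prime; first by move: p_ge5; rewrite p2. Qed.

(** Every unit modulo 24 has square 1; the residues are checked by computation. *)
Lemma sqr_p_mod24 : (p ^ 2 = 1 %[mod 24])%N.
Proof.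
have p3 : ~~ (3 %| p)%N.
  by rewrite dvdn_prime2 //; apply/eqP => p3; move: p_ge5; rewrite -p3.
have units24 : all (fun r => odd r && ~~ (3 %| r)%N ==>
                            (r ^ 2 == 1 %[mod 24])%N) (iota 0 24) by [].
rewrite -modnXm; apply/eqP.
have /allP/(_ (p %% 24)%N) := units24; rewrite mem_iota /= ltn_mod => /(_ isT)/implyP; apply.
by move: odd_p p3; lia.
Qed.

Lemma p_pow_mod24 e : exists t, (p ^ (2 * e) = 24 * t + 1)%N.
Proof.
have : (p ^ (2 * e) = 1 %[mod 24])%N by rewrite expnM -modnXm sqr_p_mod24 modnXm exp1n.
by exists ((p ^ (2 * e)) %/ 24)%N; lia.
Qed.

Lemma delta_eq : (24 * delta p + 19 = 19 * p ^ 2)%N.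
Proof. by have [t] := p_pow_mod24 1; rewrite muln1 /delta; lia. Qed.

Lemma omega_even : (2 %| omega p)%Z.
Proof.
have p_odd := odd_p; have p_gt0 := prime_gt0 p_prime.
(* For p = 19 the second term of [omega] vanishes because 19 divides [delta p]; otherwise both terms
   are odd. *)
have [p19|p_neq19] := eqVneq p 19%N.
  rewrite /omega rpredD //.
    apply: (@a_even p 0 1) => //; first by rewrite dvdn1 p19.
    by rewrite delta_eq p19.
  rewrite /legendre (_ : (p%:Z %| - (delta p)%:Z)%Z) ?mulr0 ?dvdz0 //.
  by rewrite dvdzE abszN /= p19 dvdn_mulr.
have p_ndvd19 : ~~ (p %| 19)%N by rewrite dvdn_prime2.
have [c ac] := a_reps (delta p); rewrite delta_eq [(19 * _)%N]mulnC => cE.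
(* The count for 19 p^2 is 3 R(19) or R(19) with R(19) = 4, so [c] is 3 or 1. *)
have c_odd : odd c.
  have [[u [v pE]]|p_inert] := split_or_inert p_prime p_odd.
    by move: cE; rewrite (reps_split_pow p_prime p_odd pE) // reps19; lia.
  by move: cE; rewrite reps_inert_sqr // reps19; lia.
have l1 : ~~ (p%:Z %| -2)%Z by rewrite dvdzE; apply/negP => /dvdn_leq; lia.
have l2 : ~~ (p%:Z %| - (delta p)%:Z)%Z.
  rewrite dvdzE abszN /=; apply/negP => pd; move/negP: p_ndvd19; apply.
  have : (p %| 24 * delta p + 19)%N by rewrite delta_eq dvdn_mull // dvdn_exp.
  by rewrite dvdn_addr // dvdn_mull.
have [t] := p_pow_mod24 1; rewrite muln1 => p2E.
rewrite /omega (_ : p%:Z ^+ 2 = (p ^ 2)%N%:Z); last by rewrite expr2 -PoszM mulnn.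
rewrite p2E.
by case: (legendre_odd l1) => ->; case: (legendre_odd l2) => ->; lia.
Qed.
End Main.

Local Close Scope ring_scope.

(* 57 * p ^ e is congruent to 1 modulo 8 for every odd p and even e, so all the
   divisions by 8 below are exact. *)
Theorem theorem1p3 (p : nat) (p_prime : prime p) (p_ge5 : 5 <= p) :
  ((omega p = 0 %[mod 2])%Z ->
     (forall n k j : nat, 1 <= j <= p - 1 ->
        ped (9 * p ^ (4 * k + 4) * n + 9 * p ^ (4 * k + 3) * j
             + (57 * p ^ (4 * k + 4) - 1) %/ 8) = 0 %[mod 24])
     /\
     (forall n k : nat, ~~ (19 %| 24 * n + 19) ->
        ped (9 * n + 7)
        = ped (9 * 19 ^ (4 * k + 2) * n + (57 * 19 ^ (4 * k + 2) - 1) %/ 8)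
          %[mod 24]))
  /\
  ((omega p = 1 %[mod 2])%Z ->
     (forall n k j : nat, 1 <= j <= p - 1 ->
        ped (9 * p ^ (6 * k + 6) * n + 9 * p ^ (6 * k + 5) * j
             + (57 * p ^ (6 * k + 6) - 1) %/ 8) = 0 %[mod 24])
     /\
     (p <> 19 ->
        forall n k : nat, ~~ (p %| 24 * n + 19) ->
          ped (9 * p ^ (6 * k + 2) * n + (57 * p ^ (6 * k + 2) - 1) %/ 8)
          = 0 %[mod 24])).
Proof.
have /dvdzP[w omegaE] := omega_even p_prime p_ge5.
split=> [_|]; last by move=> omega1; have := omegaE; lia.
split=> [n k j /andP[j_gt0 j_le]|n k n19].
  have [t QE] := p_pow_mod24 p_prime p_ge5 (2 * k + 2).
  have {}QE : (p ^ (4 * k + 4) = 24 * t + 1)%N by rewrite -QE; congr (p ^ _)%N; lia.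
  have Qp : (p ^ (4 * k + 4) = p ^ (4 * k + 3) * p)%N by rewrite -expnSr; congr (p ^ _)%N; lia.
  set r := (p ^ (4 * k + 3))%N in Qp *.
  (* By [QE], (57 p^(4k+4) - 1)/8 = 171 t + 7 = 9 (19 t) + 7. *)
  pose M := (p ^ (4 * k + 4) * n + r * j + 19 * t)%N.
  have -> : (9 * p ^ (4 * k + 4) * n + 9 * r * j + (57 * p ^ (4 * k + 4) - 1) %/ 8 = 9 * M + 7)%N.
    by rewrite /M QE; lia.
  (* This is the cofactor of p^(4k+3) in 24M + 19. It is 24j modulo p, so p divides 24M + 19 exactly
     4k + 3 times. *)
  have pm : ~~ (p %| 24 * (p * n) + 24 * j + 19 * p)%N.
    rewrite dvdn_addl; last exact: dvdn_mull.
    rewrite dvdn_addr; last exact/dvdn_mull/dvdn_mulr.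
    rewrite Euclid_dvdM //.
    apply/norP; split; last by apply/negP => /dvdn_leq; lia.
    by rewrite (_ : 24 = 2 ^ 3 * 3)%N // Euclid_dvdM // Euclid_dvdX // !dvdn_prime2 //; lia.
  have := a_even (k := k) (n := M) p_prime (odd_p p_prime p_ge5) pm.
  have -> : (24 * M + 19 = r * (24 * (p * n) + 24 * j + 19 * p))%N.
    rewrite (_ : 24 * M + 19 =
      p ^ (4 * k + 4) * (24 * n) + 24 * (r * j) + 19 * p ^ (4 * k + 4))%N.
      by rewrite Qp; lia.
    by rewrite /M QE; lia.
  by move=> /(_ erefl); have := ped_9n7 M; lia.
have [t QE] := p_pow_mod24 (isT : prime 19) isT (2 * k + 1).
have {}QE : (19 ^ (4 * k + 2) = 24 * t + 1)%N by rewrite -QE; congr (19 ^ _)%N; lia.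
pose M := (19 ^ (4 * k + 2) * n + 19 * t)%N.
have -> : (9 * 19 ^ (4 * k + 2) * n + (57 * 19 ^ (4 * k + 2) - 1) %/ 8 = 9 * M + 7)%N.
  by rewrite /M QE; lia.
have := @a_19 k M n n19; have -> : (24 * M + 19 = 19 ^ (4 * k + 2) * (24 * n + 19))%N.
  by rewrite /M QE; lia.
by move=> /(_ erefl); have := ped_9n7 M; have := ped_9n7 n; lia.
Qed.
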